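(* The sorting algorithm MergeInsertion needs $n\log n - c(n)\cdot n + O(\log n)$ comparisons on average to sort $n$ elements, where $c(n)\ge 1.3999$.
   Context: All logarithms are to base 2; the average is over the uniform distribution on all orderings of $n$ pairwise distinct elements, counting element comparisons. MergeInsertion (Ford–Johnson) on $n$ elements: (1) Group the elements into $\lfloor n/2\rfloor$ pairs and compare within each pair (one comparison per pair), calling the larger element of the $i$-th pair $a_i$ and the smaller $b_i$; if $n$ is odd, one element $b$ remains unpaired. (2) Sort the elements $a_i$ recursively with MergeInsertion; relabel so that $a_1<a_2<\dots<a_{\lfloor n/2\rfloor}$ and $b_i$ is the partner of $a_i$ (and the unpaired element, if any, is $b_{\lceil n/2\rceil}$). (3) The main chain is $b_1<a_1<\dots<a_{\lfloor n/2\rfloor}$; insert the remaining $b_i$ into the main chain by binary insertion, where $b_i$ ($i\le\lfloor n/2\rfloor$) is inserted among the main-chain elements smaller than $a_i$ (the unpaired element among all), in the order $b_3,b_2;\ b_5,b_4;\ b_{11},\dots,b_6;\ \dots;\ b_{t_k},b_{t_k-1},\dots,b_{t_{k-1}+1};\dots$, where $t_k=(2^{k+1}+(-1)^k)/3$ (indices exceeding the number of $b$'s are skipped, the last group being inserted starting from the largest existing index). In the analyzed (basic) variant, each element of the $k$-th group $b_{t_k},\dots,b_{t_{k-1}+1}$ is inserted by binary search over a range of at most $2^k-1$ main-chain elements, so using at most $k$ comparisons. *)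

(* Defs.v *)
From mathcomp Require Import all_boot.
From Stdlib Require Import Reals.

Set Implicit Arguments.
Unset Strict Implicit.
Unset Printing Implicit Defensive.

(* Jacobsthal-type indices t_k = (2^(k+1) + (-1)^k) / 3 *)
Definition tJ (k : nat) : nat :=
  if odd k then (2 ^ k.+1 - 1) %/ 3 else (2 ^ k.+1 + 1) %/ 3.

(* Insertion order of the indices i >= 2 of the b_i, given nb b's:
   b_3,b_2; b_5,b_4; b_11,...,b_6; ... ; indices > nb are skipped. *)
Definition insertion_order (nb : nat) : seq nat :=
  flatten [seq [seq i <- rev (iota (tJ k.-1).+1 (tJ k - tJ k.-1)) | i <= nb]
          | k <- iota 2 nb].

(* Binary insertion of x into the sorted sequence s (comparison lt x y
   means x < y): compare with the middle element s_(|s|/2) and recurse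
   into the left or right part.  Returns (insertion position, number of
   comparisons).  On 2^k - 1 elements it uses exactly k comparisons. *)
Fixpoint binpos (T : Type) (lt : T -> T -> bool) (fuel : nat) (x : T)
    (s : seq T) : nat * nat :=
  match fuel with
  | 0 => (0, 0)
  | fuel'.+1 =>
    if s is [::] then (0, 0) else
    let h := (size s)./2 in
    if lt x (nth x s h) then
      let r := binpos lt fuel' x (take h s) in (r.1, r.2.+1)
    else
      let r := binpos lt fuel' x (drop h.+1 s) in (h.+1 + r.1, r.2.+1)
  end.

Fixpoint pairup (T : Type) (lt : T -> T -> bool) (s : seq T) : seq (T * T) :=
  match s with
  | x :: y :: t => (if lt x y then (y, x) else (x, y)) :: pairup lt t
  | _ => [::]
  end.

(* The main chain is a sequence of elements tagged with 0 (a b-element)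
   or j >= 1 (the element a_j).  Insert b_i among the chain elements
   smaller than a_i, i.e. before the element tagged i; for the unpaired
   element (i = number of pairs + 1) no tag matches and the whole chain
   is the search range. *)
Definition insert_step (T : Type) (lt : T -> T -> bool)
    (acc : seq (T * nat) * nat) (ib : nat * T) : seq (T * nat) * nat :=
  let (ch, c) := acc in
  let (i, b) := ib in
  let p := find (fun e => e.2 == i) ch in
  let r := binpos lt p b (map fst (take p ch)) in
  (take r.1 ch ++ (b, 0) :: drop r.1 ch, c + r.2).

(* MergeInsertion, returning (sorted output, number of comparisons).
   [fuel] bounds the recursion depth (fuel = size s suffices). *)
Fixpoint mi (fuel : nat) (T : Type) (lt : T -> T -> bool) (s : seq T)
    {struct fuel} : seq T * nat :=
  match fuel with
  | 0 => (s, 0)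
  | fuel'.+1 =>
    if size s <= 1 then (s, 0) else
    let prs := pairup lt s in
    let rest := if odd (size s) then drop (size s).-1 s else [::] in
    let r := mi fuel' (fun p q : T * T => lt p.1 q.1) prs in
    let sorted := r.1 in
    let bs := map snd sorted ++ rest in
    let ch0 := match sorted with
               | [::] => [::]
               | p :: _ => (p.2, 0) :: zip (map fst sorted) (iota 1 (size sorted))
               end in
    let todo := pmap (fun i => omap (fun b => (i, b)) (onth bs i.-1))
                     (insertion_order (size bs)) in
    let fin := foldl (insert_step lt) (ch0, 0) todo in
    (map fst fin.1, size prs + r.2 + fin.2)
  end.

Definition mi_comparisons (s : seq nat) : nat := (mi (size s) ltn s).2.

Definition avg_mi (n : nat) : R :=
  INR (sumn [seq mi_comparisons p | p <- permutations (iota 0 n)])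
  / INR (size (permutations (iota 0 n))).

Definition log2 (x : R) : R := ln x / ln 2.

(* Main.v *)
(* Only an upper bound on the average is needed: [c n] can absorb a smaller
   average.  Instead of permuting the input, fix it and let the sorted word [w]
   vary.  Given the outcome of the pairing and the sorted main chain
   a_1 < ... < a_h, the possible words are exactly the results of inserting
   b_1, b_2, ... below a_1, a_2, ..., the i-th one in 2i-1 ways; so the recursive
   call and the insertion phase can be averaged separately.

   Let m be the number of b's.  In a complete group of insertions the worst case
   k suffices.  In the last group, where u = t_{k-1} < m <= t_k, delete
   b_{u+1}, ..., b_i from [w] to get the chain Z into which b_i is inserted.  Given
   Z, the deleted elements are distributed as if inserted in this order, each one
   uniformly below its a_j; counted by slots of Z, each choice is either a fresh
   slot of Z or the slot of an earlier deleted element.  The depths of the first q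
   of the N slots of a binary search add up to at most q (k + 1 - 2^k / N) + k, so
   by induction along these insertions the expected cost of b_i is at most
   k + 1 - 2^k / (u + m) + k / u.

   As 2^k is 3u up to 1, with r = m / 2^k the insertions of one level cost at most
   m (log m + 1 - (log r + 6 / (3r + 1))) + O(k), and log r + 6 / (3r + 1) > 1.39995
   on [1/4, 1].  The margin over 1.3999 absorbs the O(k), which leaves a bounded
   error per level, that is O(log n) in total. *)
Require Import Defs.
From Stdlib Require Import Reals Lra Psatz.
From Coquelicot Require Coquelicot.
From mathcomp Require all_boot all_order all_algebra zify ring lra Rstruct.
Open Scope R_scope.

(** * Real estimates *)

Section Derivative.
Import Coquelicot.Coquelicot.

(** The right-hand side is the [2/1] Pade approximant of [ln] at 1. Its difference from [ln] has
    derivative [(z - 1)^3 / (z (2 z + 1)^2)], which changes sign at 1, so its minimum is the value 0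
    taken there. *)
Lemma ln_le_pade (y : R) : 0 < y -> ln y <= (y - 1) * (y + 5) / (4 * y + 2).
Proof.
intros y0.
set (f := fun z => (z - 1) * (z + 5) / (4 * z + 2) - ln z).
set (f' := fun z => (z - 1) ^ 3 / (z * (2 * z + 1) ^ 2)).
assert (der : forall z, 0 < z -> derivable_pt_lim f z (f' z)).
{ intros z z0; apply is_derive_Reals; unfold f, f'.
  auto_derive; [lra | field; lra]. }
assert (f1 : f 1 = 0) by (unfold f; rewrite ln_1; lra).
cut (0 <= f y); [unfold f; lra |].
destruct (Rtotal_order y 1) as [lt_y1 | [-> | gt_y1]]; [| lra |].
- destruct (MVT_cor2 f f' y 1 lt_y1) as [c [eq_c [lt_yc lt_c1]]].
  { intros c hc; apply der; lra. }
  assert (f' c <= 0); [| nra].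
  assert (0 <= (1 - c) ^ 3 / (c * (2 * c + 1) ^ 2)).
  { apply Rmult_le_pos; [apply pow_le; lra |].
    apply Rlt_le, Rinv_0_lt_compat, Rmult_lt_0_compat; [lra | apply pow_lt; lra]. }
  replace (f' c) with (- ((1 - c) ^ 3 / (c * (2 * c + 1) ^ 2))); [lra |].
  unfold f'; field; lra.
- destruct (MVT_cor2 f f' 1 y gt_y1) as [c [eq_c [lt_1c lt_cy]]].
  { intros c hc; apply der; lra. }
  assert (0 <= f' c); [| nra].
  apply Rmult_le_pos; [apply pow_le; lra |].
  apply Rlt_le, Rinv_0_lt_compat, Rmult_lt_0_compat; [lra | apply pow_lt; lra].
Qed.

End Derivative.

Lemma ln_ge_pade (y : R) : 0 < y -> (y - 1) * (5 * y + 1) / (2 * y * (y + 2)) <= ln y.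
Proof.
intros y0; pose proof (ln_le_pade (/ y) (Rinv_0_lt_compat _ y0)) as H.
rewrite ln_Rinv in H by lra.
replace ((/ y - 1) * (/ y + 5) / (4 * / y + 2)) with
  (- ((y - 1) * (5 * y + 1) / (2 * y * (y + 2)))) in H by (field; lra).
lra.
Qed.

Lemma ln2_bounds : 0.69314 < ln 2 < 0.69316.
Proof.
(* The three arguments are so close to 1 that the Pade bounds are sharp enough. *)
assert (E : ln 2 = 7 * ln (16 / 15) + 5 * ln (25 / 24) + 3 * ln (81 / 80)).
{ replace 2 with ((16 / 15) ^ 7 * (25 / 24) ^ 5 * (81 / 80) ^ 3) by field.
  rewrite !ln_mult, !ln_pow by (try apply Rmult_lt_0_compat; try apply pow_lt; lra).
  simpl INR; lra. }
pose proof (ln_le_pade (16 / 15)); pose proof (ln_le_pade (25 / 24)).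
pose proof (ln_le_pade (81 / 80)); pose proof (ln_ge_pade (16 / 15)).
pose proof (ln_ge_pade (25 / 24)); pose proof (ln_ge_pade (81 / 80)).
lra.
Qed.

(* The minimum of the right-hand side is 1.399987, near [2 * r = 0.9906]. *)
Lemma constant_bound (r : R) : 1 / 4 <= r <= 1 -> 1.39995 <= log2 r + 6 / (3 * r + 1).
Proof.
intros hr; unfold log2; set (s := 2 * r); set (a := ln 2).
assert (ha : 0.69314 < a < 0.69316) by apply ln2_bounds.
assert (Er : ln r = ln s - a).
{ unfold s, a; rewrite ln_mult by lra; lra. }
assert (hs : 1 / 2 <= s <= 2) by (unfold s; lra).
pose proof (ln_ge_pade s) as Hs.
(* With the lower Pade bound at [s], which is sharp near the minimum, clearing denominators leaves a
   cubic in [s] that is affine in [a = ln 2]. It is checked at both ends of the interval for [a];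
   the square [(s - 0.9906)^2] fits its almost double root. *)
assert (key : 0 <= (s - 1) * (5 * s + 1) / (2 * s * (s + 2)) + a * (12 / (3 * s + 2) - 2.39995)).
{ replace ((s - 1) * (5 * s + 1) / (2 * s * (s + 2)) + a * (12 / (3 * s + 2) - 2.39995))
    with (((s - 1) * (5 * s + 1) * (3 * s + 2)
           + a * (2 * s * (s + 2)) * (12 - 2.39995 * (3 * s + 2)))
          / (2 * s * (s + 2) * (3 * s + 2))) by (field; lra).
  apply Rmult_le_pos; [| apply Rlt_le, Rinv_0_lt_compat; nra].
  assert (H1 : 0 <= (s - 1) * (5 * s + 1) * (3 * s + 2)
     + 0.69314 * (2 * s * (s + 2)) * (12 - 2.39995 * (3 * s + 2))).
  { assert (0 <= (s - 0.9906) ^ 2 * (s - 1 / 2)) by (apply Rmult_le_pos; [apply pow2_ge_0 | lra]).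
    pose proof (pow2_ge_0 (s - 0.9906)); nra. }
  assert (H2 : 0 <= (s - 1) * (5 * s + 1) * (3 * s + 2)
     + 0.69316 * (2 * s * (s + 2)) * (12 - 2.39995 * (3 * s + 2))).
  { assert (0 <= (s - 0.9906) ^ 2 * (s - 1 / 2)) by (apply Rmult_le_pos; [apply pow2_ge_0 | lra]).
    pose proof (pow2_ge_0 (s - 0.9906)); nra. }
  set (q := 2 * s * (s + 2) * (12 - 2.39995 * (3 * s + 2))) in *.
  nra. }
assert (E6 : 6 / (3 * r + 1) = 12 / (3 * s + 2)) by (unfold s; field; lra).
rewrite E6, Er; fold a.
apply (Rmult_le_reg_l a); [lra |].
replace (a * ((ln s - a) / a + 12 / (3 * s + 2))) with (ln s + a * (12 / (3 * s + 2) - 1))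
  by (field; lra).
lra.
Qed.

Lemma log2_pow_mult (k : nat) (r : R) : 0 < r -> log2 (2 ^ k * r) = INR k + log2 r.
Proof.
intros r0; pose proof ln2_bounds; unfold log2.
rewrite ln_mult, ln_pow by (try apply pow_lt; lra); field; lra.
Qed.

Lemma log2_2 : log2 2 = 1.
Proof. pose proof ln2_bounds; unfold log2; field; lra. Qed.

Lemma log2_mult (x y : R) : 0 < x -> 0 < y -> log2 (x * y) = log2 x + log2 y.
Proof. intros; pose proof ln2_bounds; unfold log2; rewrite ln_mult by lra; field; lra. Qed.

Lemma log2_le (x y : R) : 0 < x -> x <= y -> log2 x <= log2 y.
Proof.
intros x0 xy; pose proof ln2_bounds; unfold log2; apply Rmult_le_compat_r.
  apply Rlt_le, Rinv_0_lt_compat; lra.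
destruct (Rle_lt_or_eq_dec x y xy) as [lt_xy | ->]; [apply Rlt_le, ln_increasing; lra | lra].
Qed.

(** If [2^k = 3 u], the left side is exactly [n (k + 1) - 6 n 2^k / (3 n + 2^k)], which with
    [r = n / 2^k] is [n (log n + 1 - (log r + 6 / (3 r + 1)))]. The hypotheses only give
    [|2^k - 3 u| <= 1], which costs at most 3. *)
Lemma level_estimate (k : nat) (u n : R) : 1 <= u -> u + 1 <= n -> u + n <= 2 ^ k ->
  3 * u <= 2 ^ k + 1 -> 2 ^ k <= 3 * u + 1 ->
  (INR k - 2) * u + (n - u) * (INR k + 1 - 2 ^ k / (u + n)) <= n * (log2 n + 1 - 1.39995) + 3.
Proof.
intros u1 un uP uP1 Pu; set (P := 2 ^ k) in *; set (r := n / P).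
assert (P0 : 0 < P) by lra.
assert (nE : n = P * r) by (unfold r; field; lra).
assert (r0 : 0 < r) by (apply Rdiv_lt_0_compat; lra).
assert (hr : 1 / 4 <= r <= 1) by (split; apply (Rmult_le_reg_l P); lra).
pose proof (constant_bound r hr) as Hc.
assert (logE : log2 n = INR k + log2 r) by (rewrite nE; apply log2_pow_mult, r0).
assert (E6 : n * (6 / (3 * r + 1)) = 6 * n * P / (3 * n + P)) by (unfold r; field; lra).
assert (main : n * (INR k + 1) - 3 * u - P * (n - u) / (u + n)
   <= n * (INR k + 1) - 6 * n * P / (3 * n + P) + 3).
(* Deviation from the case [P = 3 u]: the last fraction is at least -2, and [P - 3 u <= 1]
   contributes the remaining 1. *)
{ assert (D : P * (n - u) / (u + n) =
      6 * n * P / (3 * n + P) - P + 2 * n * P * (P - 3 * u) / ((u + n) * (3 * n + P)))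
    by (field; lra).
  assert (0 <= 2 * n * P * (P - 3 * u + 1) / ((u + n) * (3 * n + P))).
  { apply Rmult_le_pos; [| apply Rlt_le, Rinv_0_lt_compat; nra].
    apply Rmult_le_pos; [nra | lra]. }
  assert (2 * n * P / ((u + n) * (3 * n + P)) <= 2).
  { apply (Rmult_le_reg_r ((u + n) * (3 * n + P))); [nra |].
    unfold Rdiv; rewrite Rmult_assoc, Rinv_l by nra; nra. }
  replace (2 * n * P * (P - 3 * u + 1) / ((u + n) * (3 * n + P)))
    with (2 * n * P * (P - 3 * u) / ((u + n) * (3 * n + P))
          + 2 * n * P / ((u + n) * (3 * n + P))) in * by (field; lra).
  lra. }
replace ((INR k - 2) * u + (n - u) * (INR k + 1 - P / (u + n)))
  with (n * (INR k + 1) - 3 * u - P * (n - u) / (u + n)) by (field; lra).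
rewrite logE; nra.
Qed.

Lemma sq_le_pow2 (k : nat) : INR k * INR k <= 4 * 2 ^ k.
Proof.
(* The doubling step [(j + 1)^2 <= 2 j^2] needs [j >= 3]. *)
do 3 (destruct k as [| k]; [simpl; lra |]).
induction k as [| k IH]; [simpl; lra |].
rewrite S_INR, <- tech_pow_Rmult; set (j := S (S (S k))) in *.
assert (3 <= INR j) by (unfold j; rewrite !S_INR; pose proof (pos_INR k); lra).
nra.
Qed.

(** The coefficient of [n] is the margin [1.39995 - 1.3999]. *)
Lemma log_error_absorbed (k : nat) (n : R) : 2 ^ k <= 4 * n ->
  3 * INR k + 3 <= 0.00005 * n + 1000000.
Proof.
intros H; pose proof (sq_le_pow2 k); pose proof (pos_INR k);
(* From [k^2 <= 16 n] follows [0.00005 n >= 0.000003125 k^2]. The square is AM-GM, with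
   [0.00176^2 <= 0.000003125], [2 * 0.00176 * 855 >= 3] and [855^2 + 3 <= 1000000]. *)
pose proof (pow2_ge_0 (INR k * 0.00176 - 855)); nra.
Qed.

(** With [n = h + m], apply [ln t <= t - 1] at [t = 2 x / n] for [x = h] and [x = m]. The two
    excesses add up to [(m - h)^2 / (n ln 2) <= 1 / ln 2 < 2]. *)
Lemma halving_convex (h m : R) : 0 < h -> h <= m -> m <= h + 1 ->
  h * (log2 h + 1) + m * (log2 m + 1) <= (h + m) * log2 (h + m) + 2.
Proof.
intros h0 hm mh; pose proof ln2_bounds as [L2 _]; set (n := h + m).
assert (tangent : forall x, 0 < x -> x * (log2 x + 1) <= x * log2 n + x * (2 * x / n - 1) / ln 2).
{ intros x x0; assert (Hx : ln (2 * x / n) <= 2 * x / n - 1).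
  { pose proof (exp_ineq1_le (ln (2 * x / n))) as H; rewrite exp_ln in H; [lra |].
    apply Rdiv_lt_0_compat; unfold n; lra. }
  assert (E : log2 x + 1 = log2 n + ln (2 * x / n) / ln 2).
  { assert (n0 : 0 < n) by (unfold n; lra).
    replace (ln (2 * x / n)) with (ln 2 + ln x - ln n); [unfold log2; field; lra |].
    unfold Rdiv; rewrite ln_mult, ln_mult, ln_Rinv by
      (try apply Rmult_lt_0_compat; try apply Rinv_0_lt_compat; lra).
    ring. }
  rewrite E, Rmult_plus_distr_l; apply Rplus_le_compat_l; unfold Rdiv.
  rewrite <- Rmult_assoc; apply Rmult_le_compat_r; [apply Rlt_le, Rinv_0_lt_compat; lra |].
  apply Rmult_le_compat_l; unfold Rdiv in Hx; lra. }
pose proof (tangent h h0); assert (m0 : 0 < m) by lra; pose proof (tangent m m0).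
assert (h * (2 * h / n - 1) / ln 2 + m * (2 * m / n - 1) / ln 2 <= 2).
{ replace (h * (2 * h / n - 1) / ln 2 + m * (2 * m / n - 1) / ln 2)
    with ((m - h) * ((m - h) / n) / ln 2) by (unfold n; field; lra).
  assert (0 <= (m - h) / n <= 1).
  { split; [apply Rmult_le_pos; [lra | apply Rlt_le, Rinv_0_lt_compat; unfold n; lra] |].
    apply (Rmult_le_reg_r n); [unfold n; lra |].
    unfold Rdiv; rewrite Rmult_assoc, Rinv_l by (unfold n; lra); unfold n; lra. }
  assert ((m - h) * ((m - h) / n) <= 1 * 1) by (apply Rmult_le_compat; lra).
  apply (Rmult_le_reg_r (ln 2)); [lra |].
  set (q := (m - h) * ((m - h) / n)) in *.
  replace (q / ln 2 * ln 2) with q by (field; lra); lra. }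
assert (n * log2 n = h * log2 n + m * log2 n) by (unfold n; ring).
fold n; lra.
Qed.

Module Average.
Import all_boot all_order all_algebra zify ring lra Rstruct.
Import Order.TTheory GRing.Theory Num.Theory.
Set Implicit Arguments.
Unset Strict Implicit.
Close Scope R_scope.

(** * Random orders as words *)

Section Transport.
Variables (T T' : Type) (lt : T -> T -> bool) (lt' : T' -> T' -> bool).
Variable f : T -> T'.
Hypothesis ltf : forall x y, lt' (f x) (f y) = lt x y.

Lemma binpos_map fuel x s : binpos lt' fuel (f x) (map f s) = binpos lt fuel x s.
Proof.
elim: fuel s => // fuel IH s; case: s => [//|y s].
have lt_h : (size (y :: s))./2 < size (y :: s) by rewrite /= ltnS uphalf_half; lia.
rewrite [map f _]/=; cbn [binpos]; rewrite -[f y :: map f s]/(map f (y :: s)).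
rewrite size_map (nth_map x) // ltf -map_take -map_drop.
by rewrite (IH (take _ _)) (IH (drop _ _)).
Qed.

Lemma pairup_map s :
  pairup lt' (map f s) = map (fun p => (f p.1, f p.2)) (pairup lt s).
Proof.
have [n] := ubnP (size s); elim: n s => // n IH [|x [|y s]] //= le_n.
by rewrite ltf IH; [case: (lt x y) | lia].
Qed.

Lemma insert_step_map acc ib :
  insert_step lt' (map (fun e => (f e.1, e.2)) acc.1, acc.2) (ib.1, f ib.2) =
  (map (fun e => (f e.1, e.2)) (insert_step lt acc ib).1,
   (insert_step lt acc ib).2).
Proof.
case: acc ib => ch c [i b] /=.
rewrite find_map -[find _ ch]/(find (fun e => e.2 == i) ch); set p := find _ ch.
have -> : map fst (take p (map (fun e => (f e.1, e.2)) ch)) =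
    map f (map fst (take p ch)) by rewrite -map_take -!map_comp.
rewrite binpos_map.
by rewrite map_cat /= !map_take !map_drop.
Qed.

Lemma foldl_insert_step_map acc l :
  foldl (insert_step lt') (map (fun e => (f e.1, e.2)) acc.1, acc.2)
    (map (fun ib => (ib.1, f ib.2)) l) =
  (map (fun e => (f e.1, e.2)) (foldl (insert_step lt) acc l).1,
   (foldl (insert_step lt) acc l).2).
Proof. by elim: l acc => // ib l IH acc; cbn [map foldl]; rewrite insert_step_map IH. Qed.

End Transport.

(** Naturality in the element type. It serves to rename the input, and to replace the pairs in the
    recursive call by their larger elements. *)
Lemma mi_map fuel (T T' : Type) (lt : T -> T -> bool) (lt' : T' -> T' -> bool)
    (f : T -> T') s : (forall x y, lt' (f x) (f y) = lt x y) ->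
  mi fuel lt' (map f s) = (map f (mi fuel lt s).1, (mi fuel lt s).2).
Proof.
elim: fuel T T' lt lt' f s => [|fuel IH] T T' lt lt' f s ltf //=.
rewrite size_map; case: ifP => // _.
rewrite (pairup_map ltf).
rewrite (IH _ _ (fun p q => lt p.1 q.1) _ (fun p => (f p.1, f p.2))) //=.
set r := mi _ _ _; rewrite size_map.
have -> : (if odd (size s) then drop (size s).-1 (map f s) else [::]) =
   map f (if odd (size s) then drop (size s).-1 s else [::]).
  by case: odd; rewrite // map_drop.
set rest := if _ then _ else _.
have -> : [seq i.2 | i <- [seq (f p.1, f p.2) | p <- r.1]] ++ map f rest =
   map f ([seq i.2 | i <- r.1] ++ rest).
  by rewrite map_cat -!map_comp.
set bs := _ ++ rest; rewrite size_map.
set ch0 := match r.1 with [::] => _ | _ => _ end.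
set todo' := pmap _ _; set todo := pmap _ (insertion_order _).
have -> : todo' = map (fun ib => (ib.1, f ib.2)) todo.
  rewrite /todo /todo'; elim: (insertion_order _) => //= i l ->.
  by rewrite onth_map; case: (onth bs i.-1).
set ch0' := match map _ r.1 with [::] => _ | _ => _ end.
have -> : ch0' = map (fun e => (f e.1, e.2)) ch0.
  rewrite /ch0 /ch0'; case: (r.1) => //= p l.
  congr (_ :: _ :: _).
  set k := 2; elim: l k => //= q l IHl k; congr (_ :: _); exact: IHl.
rewrite (foldl_insert_step_map ltf (ch0, 0)) [in size _]size_map -!map_comp.
by [].
Qed.

(** The word lists the elements in increasing order. A letter that does not occur has index
    [size w], hence lies above all others; the sentinel [inf] relies on this. *)
Definition ltw (T : eqType) (w : seq T) (x y : T) : bool := index x w < index y w.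

Definition mi_total (n : nat) : nat :=
  \sum_(w <- permutations (enum 'I_n)) (mi n (ltw w) (enum 'I_n)).2.

Lemma perm_eq_map_permutations (T T' : eqType) (s : seq T) (s' : seq T')
    (F : seq T -> seq T') : uniq s -> uniq s' -> size s = size s' ->
  {in permutations s &, injective F} ->
  {in permutations s, forall w, perm_eq (F w) s'} ->
  perm_eq (map F (permutations s)) (permutations s').
Proof.
move=> Us Us' eq_sz injF Fs.
have Ul : uniq (map F (permutations s)).
  by rewrite map_inj_in_uniq ?permutations_uniq.
have sub : {subset map F (permutations s) <= permutations s'}.
  by move=> _ /mapP[w ws ->]; rewrite mem_permutations Fs.
apply: uniq_perm => //; first exact: permutations_uniq.
have le_sz : size (permutations s') <= size (map F (permutations s)).
  by rewrite size_map !size_permutations // eq_sz.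
by have [] := uniq_min_size Ul sub le_sz.
Qed.

Lemma index_inj_seq (T : eqType) (s t : seq T) : uniq s -> uniq t ->
  s =i t -> {in s, forall x, index x s = index x t} -> s = t.
Proof.
move=> Us Ut eq_st eqi; have sz := perm_size (uniq_perm Us Ut eq_st).
case: s => [|x0 s'] in Us eq_st eqi sz *; first by case: t sz {Ut eq_st eqi}.
apply: (@eq_from_nth _ x0) => // i lt_i; set s := x0 :: s' in Us eq_st eqi sz lt_i *.
have xs : nth x0 s i \in s by apply: mem_nth.
have := eqi _ xs; rewrite index_uniq //; set x := nth x0 s i => iE.
by rewrite [in RHS]iE nth_index // -eq_st.
Qed.

Lemma mi_total_words (T : eqType) (s : seq T) : uniq s ->
  \sum_(w <- permutations s) (mi (size s) (ltw w) s).2 = mi_total (size s).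
Proof.
move=> Us; pose f := tnth (in_tuple s).
have injf : injective f by apply/tuple_uniqP.
have sE : map f (enum 'I_(size s)) = s by rewrite map_tnth_enum.
have sz : size (enum 'I_(size s)) = size s by rewrite size_enum_ord.
rewrite -(perm_big _ (@perm_eq_map_permutations _ _ _ s (map f)
   (enum_uniq _) Us sz (in2W (inj_map injf)) _)) /=.
  rewrite big_map /mi_total; apply: eq_bigr => w _; rewrite -{3}sE.
  rewrite (@mi_map _ _ _ (ltw w)) // => x y.
  by rewrite /ltw !index_map.
by move=> w; rewrite mem_permutations => /(perm_map f); rewrite sE.
Qed.

(** To the word [w] corresponds the inverse permutation, the input whose [i]-th entry is
    [index i w]: comparing these entries as numbers is comparing by [ltw w]. *)
Lemma mi_total_comparisons n :
  sumn [seq mi_comparisons p | p <- permutations (iota 0 n)] = mi_total n.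
Proof.
pose F (w : seq 'I_n) := [seq index i w | i <- enum 'I_n].
have sz : size (enum 'I_n) = size (iota 0 n) by rewrite size_enum_ord size_iota.
rewrite sumnE big_map.
rewrite -(perm_big _ (@perm_eq_map_permutations _ _ _ (iota 0 n) F
   (enum_uniq _) (iota_uniq _ _) sz _ _)) /=.
- rewrite big_map /mi_total; apply: eq_bigr => w _.
  rewrite /mi_comparisons size_map size_enum_ord.
  by rewrite (@mi_map _ _ _ (ltw w)).
- move=> w w'; rewrite !mem_permutations => ws ws' eqF.
  apply: index_inj_seq => [|||i _].
  + by rewrite (perm_uniq ws) enum_uniq.
  + by rewrite (perm_uniq ws') enum_uniq.
  + by move=> i; rewrite (perm_mem ws) (perm_mem ws').
  + by move/eq_in_map: eqF => /(_ i); apply; rewrite mem_enum.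
move=> w; rewrite mem_permutations => ws.
suff <- : [seq index i w | i <- w] = iota 0 n.
  by rewrite perm_sym; exact: perm_map.
have Uw : uniq w by rewrite (perm_uniq ws) enum_uniq.
have szw : size w = n by rewrite (perm_size ws) size_enum_ord.
apply: (@eq_from_nth _ 0) => [|i]; rewrite size_map ?szw ?size_iota // => lt_i.
have x0 : 'I_n by exact: Ordinal lt_i.
by rewrite (nth_map x0) ?szw // index_uniq ?szw // nth_iota.
Qed.

(** * Binary search *)

(** Depth of the [p]-th leaf in the search tree of [binpos] on [s] elements: the number of
    comparisons depends only on [s] and on the resulting slot. *)
Fixpoint slot_depth (fuel s p : nat) : nat :=
  if fuel is fuel'.+1 then
    if s == 0 then 0
    else if p <= s./2 then (slot_depth fuel' s./2 p).+1
    else (slot_depth fuel' (s - s./2.+1) (p - s./2.+1)).+1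
  else 0.

Lemma binposE (T : Type) (lt : T -> T -> bool) x0 fuel x (s : seq T) p :
    size s <= fuel -> p <= size s ->
    (forall i, i < size s -> lt x (nth x0 s i) = (p <= i)) ->
  binpos lt fuel x s = (p, slot_depth fuel (size s) p).
Proof.
elim: fuel s p => [|fuel IH] s p; first by case: s => // _; rewrite [size _]/= leqn0 => /eqP->.
case: s => [|y s] le_f le_p ltx; first by move: le_p; rewrite [size _]/= leqn0 => /eqP->.
have lt_h : (size (y :: s))./2 < size (y :: s) by rewrite /= ltnS uphalf_half; lia.
cbn [binpos slot_depth]; set s' := y :: s in le_f le_p ltx lt_h *.
rewrite (set_nth_default x0) // ltx // -/s' -[size s' == 0]/false.
have sz_take : size (take (size s')./2 s') = (size s')./2 by rewrite size_takel 1?ltnW.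
have sz_drop : size (drop (size s')./2.+1 s') = size s' - (size s')./2.+1.
  exact: size_drop.
case: leqP => [le_ph|lt_hp].
  rewrite (IH (take _ _) p) ?sz_take //; first lia.
  by move=> i lt_ih; rewrite nth_take // ltx //; lia.
rewrite (IH (drop _ _) (p - (size s')./2.+1)) ?sz_drop; first by rewrite [LHS]/= subnKC.
- lia.
- lia.
by move=> i lt_i; rewrite nth_drop ltx; lia.
Qed.

Lemma slot_depth_le fuel s p k : s < 2 ^ k -> slot_depth fuel s p <= k.
Proof.
elim: fuel s p k => // fuel IH s p [|k]; rewrite ?expnS => lt_s /=.
  by have -> : s = 0 by lia.
by case: eqP => // _; case: ifP => _; rewrite ltnS IH //; lia.
Qed.

Section PrefixSums.
Local Open Scope ring_scope.
Variable F : realFieldType.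

(** The mean leaf depth of a full binary tree with [N] leaves, all at depth [k - 1] or [k]: by
    Kraft's equality [2^k - N] of them have depth [k - 1]. *)
Definition avg_depth (k N : nat) : F := k.+1%:R - (2 ^ k)%:R / N%:R.

Lemma big_nat_split (g : nat -> nat) L q : (L <= q)%N ->
  (\sum_(0 <= p < q) g p = \sum_(0 <= p < L) g p + \sum_(0 <= p < q - L) g (L + p))%N.
Proof.
move=> le_Lq; rewrite (@big_cat_nat _ _ _ L) //=; congr addn.
by rewrite -{1}(add0n L) big_addn; apply: eq_bigr => p _; rewrite addnC.
Qed.

Lemma slot_depth_prefix_left fuel s q : (0 < s)%N -> (q <= s./2.+1)%N ->
  (\sum_(0 <= p < q) slot_depth fuel.+1 s p =
   q + \sum_(0 <= p < q) slot_depth fuel s./2 p)%N.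
Proof.
move=> s_gt0; elim: q => [|q IH] lt_q; first by rewrite !big_geq.
rewrite !big_nat_recr //= IH; last exact: ltnW.
by rewrite -ltnS lt_q eqn0Ngt s_gt0 /=; lia.
Qed.

Lemma slot_depth_prefix_right fuel s q : (0 < s)%N ->
  (\sum_(0 <= p < q) slot_depth fuel.+1 s (s./2.+1 + p) =
   q + \sum_(0 <= p < q) slot_depth fuel (s - s./2.+1) p)%N.
Proof.
move=> s_gt0; elim: q => [|q IH]; first by rewrite !big_geq.
rewrite !big_nat_recr //= IH eqn0Ngt s_gt0 /= addKn ifN; first lia.
by rewrite -ltnNge; lia.
Qed.

Lemma slot_depth_total fuel s k : (s <= fuel)%N -> (s < 2 ^ k)%N -> (2 ^ k <= 2 * s.+1)%N ->
  (\sum_(0 <= p < s.+1) slot_depth fuel s p + 2 ^ k = s.+1 * k.+1)%N.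
Proof.
elim: fuel s k => [|fuel IH] s k le_f lt_s le_s.
  have s0 : s = 0 by lia.
  by rewrite s0 in lt_s le_s *; case: k lt_s le_s => [|[|k]]; rewrite ?big_nat1 ?expnS //; lia.
have [s0|s_gt0] := posnP s.
  by rewrite s0 in lt_s le_s *; case: k lt_s le_s => [|[|k]]; rewrite ?big_nat1 ?expnS //; lia.
case: k lt_s le_s => [|k]; first by rewrite expn0; lia.
rewrite expnS => lt_s le_s.
rewrite (@big_nat_split _ s./2.+1); last by rewrite ltnS; lia.
rewrite slot_depth_prefix_left // slot_depth_prefix_right //.
(* The right subtree has [s - s./2] leaves. For even [s] it needs [2^k <= s], while only
   [2^k <= s + 1] is given; parity closes the gap unless [2^k = 1]. *)
have hP : (2 ^ k = 1 \/ exists P, 2 ^ k = 2 * P)%N.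
  by case: k {lt_s le_s} => [|k]; [left|right; exists (2 ^ k)%N; rewrite expnS].
have := IH s./2 k; have := IH (s - s./2.+1)%N k.
have -> : (s.+1 - s./2.+1 = (s - s./2.+1).+1)%N by lia.
set X := (\sum_(0 <= p < _) _)%N; set Y := (\sum_(0 <= p < _) _)%N.
set P := (2 ^ k)%N in hP lt_s le_s *.
have R1 : (s - s./2.+1 <= fuel)%N by lia.
have R2 : (s - s./2.+1 < P)%N by lia.
have R3 : (P <= 2 * (s - s./2.+1).+1)%N by case: hP => [|[Q]]; lia.
have L1 : (s./2 <= fuel)%N by lia.
have L2 : (s./2 < P)%N by lia.
have L3 : (P <= 2 * s./2.+1)%N by lia.
move=> /(_ R1 R2 R3) EX /(_ L1 L2 L3) EY.
have Es : (s.+1 = s./2.+1 + (s - s./2.+1).+1)%N by lia.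
rewrite [in RHS]Es; nia.
Qed.

Lemma ratio_itv (x y : F) : 0 <= x -> x <= y -> 0 < y -> 0 <= x / y <= 1.
Proof.
by move=> x0 xy y0; rewrite ler_pdivrMr // mul1r xy andbT divr_ge0 // ltW.
Qed.

(** Here [2 P] is the power of two of a tree with [N] leaves and [P] that of its left subtree with
    [L] leaves, so the means differ by [1 - (2 P / N - P / L)], where the 1 is the comparison at the
    root. The excess factors into two numbers of [0, 1] and [2 L - N]. *)
Lemma prefix_bound_left (q P L N : F) : 0 <= q -> q <= L -> 0 < L -> 0 < N ->
  0 <= P -> P <= N -> 2 * L <= N + 1 -> q * (2 * P / N - P / L) <= 1.
Proof.
move=> q0 qL L0 N0 P0 PN LN.
have -> : q * (2 * P / N - P / L) = q / L * (P / N) * (2 * L - N).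
  by field; rewrite !gt_eqF.
have h1 : 0 <= q / L <= 1 by apply: ratio_itv.
have h2 : 0 <= P / N <= 1 by apply: ratio_itv.
have h3 : 0 <= q / L * (P / N) <= 1.
  by case/andP: h1 h2 => ? ? /andP[? ?]; apply/andP; split; [exact: mulr_ge0|exact: mulr_ile1].
move: (q / L * (P / N)) h3 => z /andP[z0 z1]; nra.
Qed.

Lemma prefix_bound_right (q P L R : F) : 0 <= q -> q <= R -> 0 < L -> 0 < R ->
  0 <= P -> P <= L + R -> L <= R + 1 ->
  (L + q) * (2 * P / (L + R)) - P - q * (P / R) <= 1.
Proof.
move=> q0 qR L0 R0 P0 PN LR; have N0 : 0 < L + R by rewrite addr_gt0.
have -> : (L + q) * (2 * P / (L + R)) - P - q * (P / R) =
    (1 - q / R) * (P / (L + R)) * (L - R).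
  by field; rewrite !gt_eqF.
have h1 : 0 <= q / R <= 1 by apply: ratio_itv.
have h2 : 0 <= P / (L + R) <= 1. by apply: ratio_itv.
have h3 : 0 <= (1 - q / R) * (P / (L + R)) <= 1.
  case/andP: h1 h2 => ? ? /andP[? ?].
  by apply/andP; split; [apply: mulr_ge0|apply: mulr_ile1] => //; lra.
move: ((1 - q / R) * _) h3 => z /andP[z0 z1]; nra.
Qed.

(** Each level adds at most 1 to the error, since the two subtrees are almost equal. A prefix inside
    the left subtree uses [prefix_bound_left]; a longer one counts the left subtree exactly by
    [slot_depth_total] and uses [prefix_bound_right]. *)
Lemma slot_depth_prefix fuel s k q :
    (s <= fuel)%N -> (s < 2 ^ k)%N -> (2 ^ k <= 2 * s.+1)%N -> (q <= s.+1)%N ->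
  (\sum_(0 <= p < q) slot_depth fuel s p)%N%:R <= q%:R * avg_depth k s.+1 + k%:R.
Proof.
elim: fuel s k q => [|fuel IH] s k q le_f lt_s le_s le_q.
  have s0 : s = 0%N by lia.
  rewrite s0 in lt_s le_s le_q *.
  have : (k <= 1)%N by case: k lt_s le_s => [|[|k]] //; rewrite !expnS; lia.
  rewrite /avg_depth big1_eq; case: k {lt_s le_s} => [|[|]] // _; lra.
have [s0|s_gt0] := posnP s.
  rewrite s0 in lt_s le_s le_q *.
  have : (k <= 1)%N by case: k lt_s le_s => [|[|k]] //; rewrite !expnS; lia.
  rewrite big1_eq /avg_depth; case: k {lt_s le_s} => [|[|]] // _; lra.
case: k lt_s le_s => [|k]; first by rewrite expn0; lia.
rewrite expnS => lt_s le_s.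
have hP : (2 ^ k = 1 \/ exists P, 2 ^ k = 2 * P)%N.
  by case: k {lt_s le_s} => [|k]; [left|right; exists (2 ^ k)%N; rewrite expnS].
have R1 : (s - s./2.+1 <= fuel)%N by lia.
have R2 : (s - s./2.+1 < 2 ^ k)%N by lia.
have R3 : (2 ^ k <= 2 * (s - s./2.+1).+1)%N by case: hP => [|[Q]]; lia.
have L1 : (s./2 <= fuel)%N by lia.
have L2 : (s./2 < 2 ^ k)%N by lia.
have L3 : (2 ^ k <= 2 * s./2.+1)%N by lia.
have Es : (s.+1 = s./2.+1 + (s - s./2.+1).+1)%N by lia.
have EsF : s.+1%:R = s./2.+1%:R + (s - s./2.+1).+1%:R :> F by rewrite -natrD -Es.
rewrite /avg_depth expnS natrM.
have [le_qL|lt_Lq] := leqP q s./2.+1.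
  rewrite slot_depth_prefix_left // natrD.
  have := IH _ _ q L1 L2 L3 le_qL; rewrite /avg_depth.
  have le_LN : 2 * s./2.+1%:R <= s.+1%:R + 1 :> F.
    by rewrite -[2]/(2%:R) -natrM natr1 ler_nat; lia.
  have := @prefix_bound_left q%:R (2 ^ k)%:R s./2.+1%:R s.+1%:R.
  rewrite !ler0n !ltr0n !ler_nat => /(_ isT le_qL isT isT isT _ le_LN).
  have -> : (2 ^ k <= s.+1)%N by lia.
  move=> /(_ isT); rewrite -!natr1; lra.
rewrite (@big_nat_split _ s./2.+1) ?(ltnW lt_Lq) //.
rewrite slot_depth_prefix_left // slot_depth_prefix_right //.
have /(congr1 (fun n => n%:R : F)) := slot_depth_total L1 L2 L3; rewrite natrD natrM.
have le_qR : (q - s./2.+1 <= (s - s./2.+1).+1)%N by lia.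
have := IH _ _ _ R1 R2 R3 le_qR; rewrite /avg_depth.
have := @prefix_bound_right (q - s./2.+1)%:R (2 ^ k)%:R s./2.+1%:R (s - s./2.+1).+1%:R.
rewrite -EsF !ler0n !ltr0n !ler_nat natr1 ler_nat => /(_ isT le_qR isT isT isT).
have -> : (2 ^ k <= s.+1)%N by lia.
have -> : (s./2.+1 <= (s - s./2.+1).+2)%N by lia.
move=> /(_ isT isT).
have -> : q%:R = s./2.+1%:R + (q - s./2.+1)%:R :> F by rewrite -natrD subnKC // ltnW.
rewrite !natrD -[k.+2%:R]natr1 -[k.+1%:R]natr1.
move: (q - _)%:R (s - _).+1%:R s./2.+1%:R => q' R L.
move: (2 ^ k)%:R (s.+1%:R) (k%:R) (\sum_(0 <= p < _) _)%N%:R (\sum_(0 <= p < s./2.+1) _)%N%:R.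
move=> P N K X Y; move: (P / R) => z; rewrite -!mulrA; move: (P / N) => y; nra.
Qed.

End PrefixSums.

(** * Insertion into words *)

Section Fibers.
Local Open Scope ring_scope.
Variables (F : realFieldType) (I J : eqType) (key : I -> J).

Lemma natr_size (A : Type) (r : seq A) : (size r)%:R = \sum_(i <- r) 1 :> F.
Proof. by rewrite big_const_seq count_predT iter_addr_0. Qed.

Lemma big_fibers (r : seq I) (L : seq J) (f : I -> F) :
    uniq L -> {in r, forall i, key i \in L} ->
  \sum_(i <- r) f i = \sum_(j <- L) \sum_(i <- r | key i == j) f i.
Proof.
move=> UL rL; rewrite (exchange_big_dep xpredT) //=; apply: eq_big_seq => i ri.
rewrite (eq_bigl (pred1 (key i))) => [|j]; last by rewrite /= eq_sym.
by rewrite -big_filter (@filter_pred1_uniq _ _ (key i)) ?big_seq1 ?rL.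
Qed.

Lemma sum_le_fibers (r : seq I) (f : I -> F) (B : F) :
  (forall i0, i0 \in r -> \sum_(i <- r | key i == key i0) f i <=
      (count (fun i => key i == key i0) r)%:R * B) ->
  \sum_(i <- r) f i <= (size r)%:R * B.
Proof.
move=> le_fib; have rL : {in r, forall i, key i \in undup (map key r)}.
  by move=> i ri; rewrite mem_undup map_f.
rewrite natr_size !(@big_fibers r (undup (map key r))) ?undup_uniq //.
rewrite mulr_suml big_seq [leRHS]big_seq; apply: ler_sum => j.
rewrite mem_undup => /mapP[i0 ri0 ->]; apply: le_trans (le_fib i0 ri0) _.
by rewrite big_const_seq iter_addr_0.
Qed.

(** When all fibers have the same size, the bounds [c j] need only be good on average. This
    separates the recursive call from the insertion phase. *)
Lemma sum_le_equal_fibers (r : seq I) (L : seq J) (K : nat) (f : I -> F) (c : J -> F) (C : F) :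
    uniq L -> {in r, forall i, key i \in L} ->
    {in L, forall j, count (fun i => key i == j) r = K} ->
    {in L, forall j, \sum_(i <- r | key i == j) f i <= K%:R * c j} ->
    \sum_(j <- L) c j <= (size L)%:R * C ->
  \sum_(i <- r) f i <= (size r)%:R * C.
Proof.
move=> UL rL cK le_f le_c.
have -> : (size r)%:R = K%:R * (size L)%:R :> F.
  rewrite natr_size (big_fibers _ UL) // (eq_big_seq (fun=> K%:R)) => [|j jL].
    by rewrite big_const_seq count_predT iter_addr_0 mulr_natr.
  by rewrite big_const_seq iter_addr_0 cK.
rewrite (big_fibers _ UL) // -mulrA; apply: le_trans (ler_wpM2l (ler0n _ _) le_c).
by rewrite mulr_sumr big_seq [leRHS]big_seq; apply: ler_sum.
Qed.

End Fibers.

Section Words.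
Variable T : eqType.
Implicit Types (w Z : seq T) (P Q : pred T).

(** The slot of [x] in the subword [filter P w], meaningful also for [x] outside [P]. *)
Definition rank P w x := count P (take (index x w) w).

Lemma rank_cons P y w x :
  rank P (y :: w) x = if y == x then 0 else P y + rank P w x.
Proof. by rewrite /rank /=; case: eqP. Qed.

Lemma rank_filter P Q w x : {in w, forall y, P y -> Q y} -> Q x ->
  rank P (filter Q w) x = rank P w x.
Proof.
elim: w => //= y w IH PQ Qx; rewrite rank_cons -{}IH //; last first.
  by move=> z wz; apply: PQ; rewrite inE wz orbT.
case: ifPn => Qy; first by rewrite rank_cons.
case: eqP => [yx|_]; first by rewrite yx Qx in Qy.
by case: (boolP (P y)) => // /(PQ y (mem_head _ _)); rewrite (negbTE Qy).
Qed.

Lemma index_filter P w x : (x \in w -> P x) -> index x (filter P w) = rank P w x.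
Proof.
elim: w => //= y w IH Px; rewrite rank_cons -IH => [|xw]; last first.
  by rewrite Px // inE xw orbT.
case: ifPn => Py //=; case: eqP => // yx.
by move: Py; rewrite yx Px // -yx mem_head.
Qed.

Lemma index_filter_lt P w x a : P x -> P a ->
  (index x (filter P w) < index a (filter P w)) = (index x w < index a w).
Proof.
move=> Px Pa; elim: w => //= y w IH; case: ifPn => Py /=.
  by case: eqP => _; case: eqP => //= _; rewrite ltnS.
case: eqP => [yx|_]; first by rewrite yx Px in Py.
by case: eqP => [ya|_]; first by rewrite ya Pa in Py.
Qed.

Lemma rank_le_mono P w x y : index x w <= index y w -> rank P w x <= rank P w y.
Proof.
move=> le_xy; rewrite /rank -(subnKC le_xy) takeD count_cat; exact: leq_addr.
Qed.

Definition insert_at x p w := take p w ++ x :: drop p w.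

Lemma index_insert_at x p w : x \notin w -> p <= size w -> index x (insert_at x p w) = p.
Proof.
move=> xw le_p; rewrite /insert_at index_cat ifN /= ?eqxx ?addn0 ?size_takel //.
by apply: contra xw; apply: mem_take.
Qed.

Lemma index_insert_at_lt x a p w : x \notin w -> a != x -> p <= size w ->
  (index x (insert_at x p w) < index a (insert_at x p w)) = (p <= index a w).
Proof.
move=> xw ax le_p; rewrite index_insert_at // -[in RHS](cat_take_drop p w).
rewrite /insert_at !index_cat size_takel //; case: ifP => aT.
  move: aT; rewrite -index_mem size_takel //; move: (index _ _) => j; lia.
by rewrite /= eq_sym (negbTE ax); lia.
Qed.

Lemma insert_atK x p w : x \notin w -> filter (predC1 x) (insert_at x p w) = w.
Proof.
move=> xw; rewrite filter_cat /= eqxx /= -filter_cat cat_take_drop.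
by apply/all_filterP/allP => y; apply: contraTneq => ->.
Qed.

Lemma perm_insert_at x p w : perm_eq (insert_at x p w) (x :: w).
Proof. by rewrite /insert_at -cat1s perm_catCA /= perm_cons cat_take_drop. Qed.

Lemma insert_at_filter x w : uniq w -> x \in w ->
  insert_at x (index x w) (filter (predC1 x) w) = w.
Proof.
elim: w => //= y w IH /andP[yw Uw]; rewrite inE eq_sym; case: eqP => [e|yx] /= wx.
  subst y.
  rewrite /insert_at take0 drop0 /=; congr (_ :: _).
  by apply/all_filterP/allP => z; apply: contraTneq => ->.
by rewrite /insert_at /=; congr (_ :: _); apply: IH.
Qed.

(* Insert [xa.1] anywhere before [xa.2]; if [xa.2] does not occur in the word,
   [index] is the size and every position is allowed. *)
Definition ext_step ws (xa : T * T) :=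
  [seq insert_at xa.1 p w | w <- ws, p <- iota 0 (index xa.2 w).+1].

Definition ext (xs : seq (T * T)) Z := foldl ext_step [:: Z] xs.

Lemma ext_rcons xs xa Z : ext (rcons xs xa) Z = ext_step (ext xs Z) xa.
Proof. by rewrite /ext -cats1 foldl_cat. Qed.

(** Bounds are never inserted letters, so every constraint survives later insertions and the
    deletion of inserted letters. *)
Definition ext_wf (xs : seq (T * T)) Z :=
  uniq (unzip1 xs ++ Z) && all (fun xa => xa.2 \notin unzip1 xs) xs.

Lemma ext_wf_rcons xs xa Z : ext_wf (rcons xs xa) Z ->
  [/\ ext_wf xs Z, xa.1 \notin unzip1 xs ++ Z, xa.2 \notin unzip1 xs, xa.2 != xa.1
    & all (fun yb => yb.2 != xa.1) xs].
Proof.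
rewrite /ext_wf /unzip1 map_rcons all_rcons => /andP[Ux /andP[ax axs]].
move: Ux; rewrite cat_rcons -cat1s uniq_catCA cat1s /= => /andP[xN Ux].
rewrite Ux xN; move: ax; rewrite mem_rcons inE negb_or => /andP[-> ->].
split=> //; apply/allP => yb /(allP axs); rewrite mem_rcons inE negb_or => /andP[] //.
Qed.

Lemma perm_rcons_cat x s Z w : perm_eq (x :: w) (rcons s x ++ Z) = perm_eq w (s ++ Z).
Proof. by rewrite cat_rcons -[x :: Z]cat1s perm_sym perm_catCA perm_cons perm_sym. Qed.

(** The inverse of an insertion is the deletion of its letter. The resulting description does not
    depend on the order of [xs], which is what allows [ext_fiber] to regroup insertions. *)
Lemma mem_ext xs Z : ext_wf xs Z -> forall w,
  (w \in ext xs Z) = [&& perm_eq w (unzip1 xs ++ Z),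
     filter [predC unzip1 xs] w == Z & all (fun xa => index xa.1 w < index xa.2 w) xs].
Proof.
elim/last_ind: xs => [|xs [x a] IH] wf w.
  rewrite inE andbT /= filter_predT; apply/eqP/andP => [->|[_ /eqP]] //.
have [wf' /= xN aN ax axs] := ext_wf_rcons wf.
rewrite ext_rcons /unzip1 map_rcons all_rcons /=.
have Uxs : uniq (unzip1 xs ++ Z) by case/andP: wf'.
have xM w' : perm_eq w' (unzip1 xs ++ Z) -> x \notin w' by move/perm_mem->.
have allE w' : all (fun xa => index xa.1 (filter (predC1 x) w') <
    index xa.2 (filter (predC1 x) w')) xs = all (fun xa => index xa.1 w' < index xa.2 w') xs.
  apply: eq_in_all => -[y b] xs_yb; apply: index_filter_lt => /=.
    apply: contraNneq xN => <-; rewrite mem_cat; apply/orP; left.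
    by apply/mapP; exists (y, b).
  exact: (allP axs (y, b)).
have filtE w' : filter [predC unzip1 xs] (filter (predC1 x) w') =
    filter [predC rcons (unzip1 xs) x] w'.
  rewrite -filter_predI; apply: eq_filter => y.
  by rewrite /= mem_rcons !inE negb_or andbC.
apply/allpairsPdep/and3P => [[w' [p [w'E]]]|[pw /eqP fw /andP[xa_w all_w]]].
  rewrite mem_iota add0n ltnS => /= le_p ->.
  have le_pw := leq_trans le_p (index_size a w').
  move: w'E; rewrite IH // => /and3P[pw' /eqP fw' aw']; have xw' := xM _ pw'.
  split.
  - by rewrite (permPl (perm_insert_at _ _ _)) perm_rcons_cat.
  - by rewrite -filtE insert_atK // fw'.
  by rewrite index_insert_at_lt // le_p -allE insert_atK.
have Uw : uniq w by rewrite (perm_uniq pw); case/andP: wf; rewrite /unzip1 map_rcons.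
have xw : x \in w by rewrite (perm_mem pw) mem_cat mem_rcons mem_head.
pose w' := filter (predC1 x) w.
have wE : insert_at x (index x w) w' = w by exact: insert_at_filter.
have pw' : perm_eq w' (unzip1 xs ++ Z).
  rewrite -(perm_rcons_cat x) -(permPr pw) -wE perm_sym.
  exact: perm_insert_at.
exists w', (index x w); split; [|rewrite mem_iota add0n ltnS /=|exact: esym wE].
  by rewrite IH // pw' filtE fw eqxx allE all_w.
have szw : index x w <= size w'.
  have := perm_size (perm_insert_at x (index x w) w'); rewrite wE /= => szw.
  by rewrite -ltnS -szw index_mem.
by rewrite -(index_insert_at_lt (xM _ pw') ax szw) wE.
Qed.

Lemma ext_uniq xs Z : ext_wf xs Z -> uniq (ext xs Z).
Proof.
elim/last_ind: xs => [|xs [x a] IH] wf //.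
have [wf' /= xN aN ax axs] := ext_wf_rcons wf.
have xM w' : w' \in ext xs Z -> x \notin w'.
  by rewrite mem_ext // => /and3P[/perm_mem-> _ _].
rewrite ext_rcons; apply: allpairs_uniq_dep => [|w _|]; [exact: IH|exact: iota_uniq|].
move=> _ _ /allpairsPdep[w [p [wE pE ->]]] /allpairsPdep[w' [p' [w'E p'E ->]]] /= eqi.
have eqw : w = w'.
  by have := congr1 (filter (predC1 x)) eqi; rewrite !insert_atK ?xM.
rewrite -{w'}eqw in w'E p'E eqi *; have := congr1 (index x) eqi.
move: pE p'E; rewrite !mem_iota !add0n !ltnS => /= le_p le_p'.
by rewrite !index_insert_at ?xM ?(leq_trans _ (index_size a w)) // => ->.
Qed.

(** Every inserted letter lies below its own bound, which is at most [a]. Hence the next insertion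
    has the same number of choices in all words, and the insertions are uniform. *)
Lemma index_ext xs Z w a : ext_wf xs Z -> w \in ext xs Z -> a \notin unzip1 xs ->
    all (fun yb => index yb.2 Z <= index a Z) xs ->
  {in unzip1 xs, forall y, index y w < index a w} /\ index a w = index a Z + size xs.
Proof.
move=> wf wE aN le_a; have := wE; rewrite mem_ext // => /and3P[pw /eqP fw aw].
have Uw : uniq w by rewrite (perm_uniq pw); case/andP: wf.
have before : {in unzip1 xs, forall y, index y w < index a w}.
  move=> y /mapP[[y' b] xs_yb ->] /=; apply: leq_trans (allP aw _ xs_yb) _ => /=.
  rewrite leqNgt -(@index_filter_lt [predC unzip1 xs]) /= ?fw -?leqNgt //.
    exact: (allP le_a _ xs_yb).
  by case/andP: wf => _ /allP/(_ _ xs_yb).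
split=> //; rewrite -fw index_filter //= /rank.
rewrite -{1}(size_takel (index_size a w)) -(count_predC (mem (unzip1 xs))) addnC.
congr (_ + _).
rewrite -size_filter -(size_map fst); apply: perm_size; apply: uniq_perm.
- by rewrite filter_uniq // take_uniq.
- by case/andP: wf; rewrite cat_uniq => /andP[].
move=> y; rewrite mem_filter /= andb_idr // => ys.
by rewrite in_take_leq ?index_size // before.
Qed.

End Words.

Section ExtAverage.
Local Open Scope ring_scope.
Variables (F : realFieldType) (T : eqType).
Implicit Types (w Z : seq T) (P : pred T) (g : nat -> F).

(* An element outside [P] splits a slot in two, and the new half has the value of
   that element. *)
Lemma sum_slots P g v : uniq v ->
  \sum_(0 <= p < (size v).+1) g (count P (take p v)) =
  \sum_(0 <= q < (count P v).+1) g q + \sum_(y <- v | ~~ P y) g (rank P v y).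
Proof.
elim/last_ind: v => [|v y IH] Uv; first by rewrite !big_nat1 big_nil addr0.
move: Uv; rewrite rcons_uniq => /andP[yv Uv].
rewrite size_rcons big_nat_recr //= take_oversize ?size_rcons //.
rewrite -[in RHS]cats1 big_cat /= [X in _ = _ + (_ + X)]big_mkcond big_seq1 cats1.
have -> : \sum_(0 <= p < (size v).+1) g (count P (take p (rcons v y))) =
    \sum_(0 <= p < (size v).+1) g (count P (take p v)).
  apply: eq_big_nat => p /andP[_]; rewrite ltnS => le_p.
  by rewrite -cats1 takel_cat.
have -> : \sum_(z <- v | ~~ P z) g (rank P (rcons v y) z) =
    \sum_(z <- v | ~~ P z) g (rank P v z).
  rewrite big_seq_cond [RHS]big_seq_cond; apply: eq_bigr => z /andP[vz _].
  by rewrite /rank -cats1 index_cat vz takel_cat // index_size.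
rewrite IH // -cats1 count_cat /= addn0; case: (boolP (P y)) => Py /=.
  by rewrite addn1 [in RHS]big_nat_recr //= addr0 addrAC.
rewrite addn0 -addrA; congr (_ + (_ + g _)).
by rewrite /rank index_cat (negbTE yv) /= eqxx addn0 take_cat ltnn subnn take0 cats0.
Qed.

Lemma rank_ext xs Z w a : ext_wf xs Z -> w \in ext xs Z -> a \notin unzip1 xs ->
  rank (mem Z) w a = index a Z.
Proof.
move=> wf; rewrite mem_ext // => /and3P[pw /eqP fw _] aN.
rewrite -[in RHS]fw index_filter //=; apply: eq_in_count => y /mem_take.
rewrite (perm_mem pw) mem_cat /=; case/andP: wf; rewrite cat_uniq.
by case/and3P=> _ /hasPn dis _ _ /orP[yx|yZ]; rewrite ?yx ?yZ ?(negbTE (dis _ _)) //;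
  apply/negbTE; apply: contraTN yx => /dis.
Qed.

(** Below [a] the word consists of the letters of [Z] below [a] and of all letters inserted so far;
    [sum_slots] applies to this prefix. *)
Lemma sum_last_slot xs x a Z g w : ext_wf (rcons xs (x, a)) Z ->
    all (fun yb => index yb.2 Z <= index a Z)%N xs -> w \in ext xs Z ->
  \sum_(p <- iota 0 (index a w).+1) g (rank (mem Z) (insert_at x p w) x) =
  \sum_(0 <= q < (index a Z).+1) g q + \sum_(y <- unzip1 xs) g (rank (mem Z) w y).
Proof.
move=> wfr le_a wE; have [wf /= xN aN ax axs] := ext_wf_rcons wfr.
have [before _] := index_ext wf wE aN le_a.
have pw : perm_eq w (unzip1 xs ++ Z) by move: wE; rewrite mem_ext // => /and3P[].
have Uw : uniq w by rewrite (perm_uniq pw); case/andP: wf.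
have xw : x \notin w by rewrite (perm_mem pw).
pose v := take (index a w) w; have szv : size v = index a w by rewrite size_takel ?index_size.
have Uv : uniq v by rewrite take_uniq.
have -> : index a Z = count (mem Z) v by rewrite -(rank_ext wf wE aN).
transitivity (\sum_(0 <= p < (size v).+1) g (count (mem Z) (take p v))).
  rewrite szv; change (0%N :: iota 1 (index a w)) with (index_iota 0 (index a w).+1).
  rewrite big_seq [RHS]big_seq; apply: eq_bigr => p; rewrite mem_index_iota ltnS => /= le_p.
  rewrite /rank index_insert_at ?(leq_trans le_p) ?index_size //.
  rewrite /insert_at take_size_cat ?size_takel ?(leq_trans le_p) ?index_size //.
  by rewrite take_takel.
rewrite sum_slots //; congr (_ + _).
rewrite -(big_filter v (fun y => ~~ mem Z y)). set u := filter _ v.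
have pv : perm_eq u (unzip1 xs).
  have UxZ : uniq (unzip1 xs ++ Z) by case/andP: wf.
  move: UxZ; rewrite cat_uniq => /and3P[Ux /hasPn dis _].
  apply: uniq_perm => //; first by rewrite filter_uniq.
  move=> y; rewrite mem_filter /=; apply/andP/idP => [[yZ /mem_take]|yx].
    by rewrite (perm_mem pw) mem_cat (negbTE yZ) orbF.
  split; first by apply: contraTN yx => /dis.
  by rewrite in_take_leq ?index_size // before.
rewrite (perm_big _ pv); apply: eq_big_seq => y yx.
rewrite /rank /v; have lt_y := before _ yx.
have yv : y \in v by rewrite in_take_leq ?index_size.
have -> : index y (take (index a w) w) = index y w.
  by rewrite -[w in RHS](cat_take_drop (index a w)) index_cat yv.
by rewrite take_takel // ltnW.
Qed.

Lemma rank_insert_at xs x a Z w p y : ext_wf (rcons xs (x, a)) Z ->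
    w \in ext xs Z -> y \in unzip1 xs ->
  rank (mem Z) (insert_at x p w) y = rank (mem Z) w y.
Proof.
move=> wfr wE yx; have [wf /= xN aN ax axs] := ext_wf_rcons wfr.
have pw : perm_eq w (unzip1 xs ++ Z) by move: wE; rewrite mem_ext // => /and3P[].
have xw : x \notin w by rewrite (perm_mem pw).
rewrite -[in RHS](insert_atK p xw) rank_filter //=.
  move=> z _ /= zZ; apply: contraNneq xN => <-; by rewrite mem_cat zZ orbT.
by apply: contraNneq xN => <-; rewrite mem_cat yx.
Qed.

Variables (g : nat -> F) (A D e : F) (Z : seq T).

(** [A] is the intended mean, [D] the error of a prefix sum, and [e] this error per slot once
    [z + 1] slots share it. *)
Definition prefix_bounded (z : nat) :=
  (\sum_(0 <= q < z.+1) g q <= z.+1%:R * A + D) && (D <= z.+1%:R * e).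

Definition sorted_bounds (xs : seq (T * T)) :=
  pairwise (fun xa yb => index xa.2 Z <= index yb.2 Z)%N xs.

Lemma sorted_bounds_rcons xs xa : sorted_bounds (rcons xs xa) ->
  sorted_bounds xs /\ all (fun yb => index yb.2 Z <= index xa.2 Z)%N xs.
Proof. by rewrite /sorted_bounds pairwise_rcons => /andP[]. Qed.

Lemma size_ext_rcons xs x a : ext_wf (rcons xs (x, a)) Z -> sorted_bounds (rcons xs (x, a)) ->
  size (ext (rcons xs (x, a)) Z) = (size (ext xs Z) * (index a Z + size xs).+1)%N.
Proof.
move=> wfr /sorted_bounds_rcons[_ le_a]; have [wf /= xN aN ax axs] := ext_wf_rcons wfr.
rewrite ext_rcons size_allpairs_dep sumnE big_map -sum1_size big_distrl /=.
apply: eq_big_seq => w wE; rewrite size_iota mul1n.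
by have [_ ->] := index_ext wf wE aN le_a.
Qed.

Definition slot_sum (xs : seq (T * T)) w : F := \sum_(y <- unzip1 xs) g (rank (mem Z) w y).

Lemma sum_ext_last xs x a : ext_wf (rcons xs (x, a)) Z -> sorted_bounds (rcons xs (x, a)) ->
  \sum_(w <- ext (rcons xs (x, a)) Z) g (rank (mem Z) w x) =
  (size (ext xs Z))%:R * \sum_(0 <= q < (index a Z).+1) g q + \sum_(w <- ext xs Z) slot_sum xs w.
Proof.
move=> wfr /sorted_bounds_rcons[_ le_a].
rewrite ext_rcons big_allpairs_dep /=.
transitivity (\sum_(w <- ext xs Z) (\sum_(0 <= q < (index a Z).+1) g q + slot_sum xs w)).
  by apply: eq_big_seq => w wE; rewrite -(sum_last_slot g wfr le_a wE).
by rewrite big_split /= big_const_seq count_predT iter_addr_0 mulr_natl.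
Qed.

Lemma sum_ext_rest xs x a : ext_wf (rcons xs (x, a)) Z -> sorted_bounds (rcons xs (x, a)) ->
  \sum_(w <- ext (rcons xs (x, a)) Z) slot_sum xs w =
  (index a Z + size xs).+1%:R * \sum_(w <- ext xs Z) slot_sum xs w.
Proof.
move=> wfr /sorted_bounds_rcons[_ le_a]; have [wf /= xN aN ax axs] := ext_wf_rcons wfr.
rewrite ext_rcons big_allpairs_dep /= mulr_sumr.
apply: eq_big_seq => w wE; have [_ <-] := index_ext wf wE aN le_a.
rewrite (eq_bigr (fun=> slot_sum xs w)) => [|p _].
  by rewrite big_const_seq count_predT iter_addr_0 /= size_iota mulr_natl.
by apply: eq_big_seq => y yx; rewrite (rank_insert_at _ wfr).
Qed.

Lemma slot_sum_rcons xs x a w :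
  slot_sum (rcons xs (x, a)) w = slot_sum xs w + g (rank (mem Z) w x).
Proof. by rewrite /slot_sum /unzip1 map_rcons -cats1 big_cat big_seq1. Qed.

(** With [z = index a Z] and [n] earlier insertions, the last letter has [z + 1] fresh slots, of
    total cost at most [(z + 1) A + D <= (z + 1) (A + e)], and [n] inherited ones, of mean total
    cost at most [n (A + e)]. *)
Lemma sum_ext_last_le xs x a : ext_wf (rcons xs (x, a)) Z ->
    sorted_bounds (rcons xs (x, a)) -> prefix_bounded (index a Z) ->
    \sum_(w <- ext xs Z) slot_sum xs w <= (size (ext xs Z))%:R * ((size xs)%:R * (A + e)) ->
  \sum_(w <- ext (rcons xs (x, a)) Z) g (rank (mem Z) w x) <=
    (size (ext (rcons xs (x, a)) Z))%:R * (A + e).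
Proof.
move=> wf sb /andP[leG leD] leH; rewrite sum_ext_last // size_ext_rcons // natrM -mulrA.
apply: le_trans (lerD (lexx _) leH) _; rewrite -mulrDr; apply: ler_wpM2l => //.
rewrite -addSn natrD; move: (_.+1%:R) (size xs)%:R leG leD => z n; lra.
Qed.

Lemma sum_ext_le xs : ext_wf xs Z -> sorted_bounds xs ->
    all (fun xa => prefix_bounded (index xa.2 Z)) xs ->
  \sum_(w <- ext xs Z) slot_sum xs w <= (size (ext xs Z))%:R * ((size xs)%:R * (A + e)).
Proof.
elim/last_ind: xs => [|xs [x a] IH] wfr sb.
  by rewrite big_seq1 /slot_sum big_nil mul0r mulr0.
have [wf _ _ _ _] := ext_wf_rcons wfr; have [sb' _] := sorted_bounds_rcons sb.
rewrite all_rcons => /andP[pb pbs]; have leH := IH wf sb' pbs.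
under eq_bigr => w _ do rewrite slot_sum_rcons.
rewrite big_split /= size_rcons -natr1 mulrDl mulrDr mul1r.
apply: lerD (sum_ext_last_le wfr sb pb leH).
rewrite sum_ext_rest // size_ext_rcons // natrM -mulrA mulrCA.
by apply: ler_wpM2l.
Qed.

Lemma avg_ext_last_le xs x a : ext_wf (rcons xs (x, a)) Z ->
    sorted_bounds (rcons xs (x, a)) ->
    all (fun xa => prefix_bounded (index xa.2 Z)) (rcons xs (x, a)) ->
  \sum_(w <- ext (rcons xs (x, a)) Z) g (rank (mem Z) w x) <=
    (size (ext (rcons xs (x, a)) Z))%:R * (A + e).
Proof.
move=> wfr sb; rewrite all_rcons => /andP[pb pbs].
have [wf _ _ _ _] := ext_wf_rcons wfr; have [sb' _] := sorted_bounds_rcons sb.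
by apply: sum_ext_last_le => //; apply: sum_ext_le.
Qed.

End ExtAverage.

(** * The insertion phase *)

Lemma Nat_powE a b : Nat.pow a b = a ^ b.
Proof. by elim: b => //= b ->; rewrite expnS. Qed.

Lemma tJ3 k : if odd k then 3 * tJ k + 1 = 2 ^ k.+1 else 3 * tJ k = 2 ^ k.+1 + 1.
Proof.
suff : if odd k then exists q, 2 ^ k.+1 = 3 * q + 1 else exists q, 2 ^ k.+1 = 3 * q + 2.
  rewrite /tJ Nat_powE; case: odd => [[q ->]|[q ->]].
    by rewrite addnK mulKn.
  by rewrite -addnA -[2 + 1]/(3 * 1) -mulnDr mulKn.
elim: k => [|k IH]; first by exists 0.
by rewrite expnS /=; case: odd IH => [[q ->]|[q ->]] /=;
  [exists (2 * q)|exists (2 * q + 1)]; lia.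
Qed.

(** This identity makes the groups fit binary search: in the [k]-th group a search range has fewer
    than [t_{k-1} + t_k = 2^k] elements, see [rank_group_le]. *)
Lemma tJS k : tJ k.+1 + tJ k = 2 ^ k.+1.
Proof. by have := tJ3 k; have := tJ3 k.+1; rewrite expnS /=; case: odd => /=; lia. Qed.

Lemma tJ_gt0 k : 0 < tJ k.
Proof. by have := tJ3 k; rewrite expnS; have := expn_gt0 2 k; case: odd; lia. Qed.

Lemma tJS_le k : tJ k.+1 <= (tJ k).*2.+1.
Proof. by have := tJ3 k; have := tJ3 k.+1; rewrite !expnS /=; case: odd => /=; lia. Qed.

Lemma leq_tJS k : tJ k <= tJ k.+1.
Proof.
have := tJ3 k; have := tJ3 k.+1; have := expn_gt0 2 k; rewrite !expnS /=.
by case: odd => /=; lia.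
Qed.

Lemma leq_tJ k : k <= tJ k.+1.
Proof.
have := tJ3 k.+1; have := ltn_expl k (isT : 1 < 2); rewrite !expnS /=.
by case: odd => /=; lia.
Qed.

(** The cut at [m] is moved from a filter into the length, so that truncated subtraction makes the
    groups beyond [m] empty. *)
Definition group k m := rev (iota (tJ k.-1).+1 (minn (tJ k) m - tJ k.-1)).

Lemma insertion_orderE m : insertion_order m = flatten [seq group k m | k <- iota 2 m].
Proof.
rewrite /insertion_order; congr flatten; apply: eq_map => k.
rewrite filter_rev; congr rev; move: (tJ k.-1) (tJ k) => a b.
rewrite subn_minl; move: (b - a) => l {b}.
elim: l a => [|l IH] a /=; first by rewrite min0n.
rewrite IH; case: ltnP => lt_am.
  by have -> : minn l.+1 (m - a) = (minn l (m - a.+1)).+1 by lia.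
have -> : minn l.+1 (m - a) = 0 by lia.
by have -> : minn l (m - a.+1) = 0 by lia.
Qed.

Lemma mem_group k m i : i \in group k m = (tJ k.-1 < i <= minn (tJ k) m).
Proof. by rewrite mem_rev mem_iota; lia. Qed.

Section RankNth.
Variable T : eqType.
Implicit Types (w S : seq T) (P : pred T).

Lemma rank_nth P w x x0 j : uniq w -> x \in w -> ~~ P x -> j < count P w ->
  (index x w < index (nth x0 (filter P w) j) w) = (rank P w x <= j).
Proof.
move=> + + NPx; elim: w j => //= y w IH j /andP[yw Uw].
have neq_y i : i < count P w -> (y == nth x0 (filter P w) i) = false.
  move=> lt_i; apply: contraNF yw => /eqP->.
  by apply: (mem_subseq (filter_subseq P w)); rewrite mem_nth // size_filter.
rewrite rank_cons inE eq_sym; case: eqP => [yx|yx] /= xw.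
  rewrite yx (negbTE NPx) /= => lt_j; rewrite -yx neq_y //.
case: (boolP (P y)) => Py /=; last by rewrite ?add0n => lt_j; rewrite neq_y // ltnS IH.
case: j => [|j] /=; first by rewrite eqxx.
by rewrite ?add1n ?add0n ?ltnS => lt_j; rewrite neq_y // ltnS IH.
Qed.

Lemma filter_insert_rank P w x : uniq w -> x \in w -> ~~ P x ->
  take (rank P w x) (filter P w) ++ x :: drop (rank P w x) (filter P w) =
  filter (predU1 x P) w.
Proof.
move=> + + NPx; elim: w => //= y w IH /andP[yw Uw].
rewrite rank_cons inE eq_sym; case: eqP => [yx|yx] /= xw.
  rewrite yx (negbTE NPx) take0 drop0 /=; congr (_ :: _).
  apply: eq_in_filter => z zw /=; case: eqP => // zx.
  by rewrite yx -zx zw in yw.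
by case: (boolP (P y)) => Py /=; rewrite -IH.
Qed.

End RankNth.

Section InsertionPhase.
Variables (T : eqType) (inf : T) (w sg bs : seq T).
Hypothesis Uw : uniq w.
Hypothesis infw : inf \notin w.
Hypothesis wE : w =i sg ++ bs.
Hypothesis Usb : uniq (sg ++ bs).
Hypothesis sgE : filter (mem sg) w = sg.
Hypothesis lt_ab : forall i, i < size bs -> index (nth inf bs i) w < index (nth inf sg i) w.
Hypothesis sz_bs : size bs <= (size sg).+1.

Local Notation alpha i := (nth inf sg i.-1).
Local Notation beta i := (nth inf bs i.-1).
Local Notation m := (size bs).

Definition tag x := if x \in sg then (index x sg).+1 else 0.
(** The invariant of the insertion phase: the current chain is the word [w] restricted to the set
    [S] of elements present. *)
Definition chain (S : seq T) := [seq (x, tag x) | x <- w & x \in S].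

(** For the unpaired element [alpha i] is [inf], whose rank is the length of the whole chain. *)
Definition step_cost (S : seq T) i :=
  slot_depth (rank (mem S) w (alpha i)) (rank (mem S) w (alpha i)) (rank (mem S) w (beta i)).

Lemma eq_chain S S' : S =i S' -> chain S = chain S'.
Proof. by move=> eqS; rewrite /chain (eq_filter (a2 := mem S')) // => x; apply: eqS. Qed.

Lemma insert_stepE S c i : 0 < i <= m -> {subset sg <= S} -> beta i \notin S ->
  insert_step (ltw w) (chain S, c) (i, beta i) = (chain (beta i :: S), c + step_cost S i).
Proof.
case: i => // i; rewrite ![i.+1.-1]/= => lt_im sgS bS.
have bw : nth inf bs i \in w by rewrite wE mem_cat mem_nth ?orbT.
set b := nth inf bs i in bS bw *; set a := nth inf sg i.
set p := rank (mem S) w a; set r := rank (mem S) w b.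
(* If [a] is [inf], no tag matches and both sides are the length of the chain. *)
have findE : find (fun e : T * nat => e.2 == i.+1) (chain S) = p.
  rewrite /chain find_map /p -index_filter => [|aw]; last first.
    apply: sgS; rewrite mem_nth //; case: ltnP => // ge_i.
    by rewrite /a nth_default // (negbTE infw) in aw.
  apply: eq_in_find => x; rewrite mem_filter => /andP[_ xw] /=.
  rewrite /tag; case: ifP => xsg; last first.
    apply/esym/eqP => xa; case: (ltnP i (size sg)) => [lt_i|ge_i].
      by rewrite xa mem_nth in xsg.
    by rewrite xa /a nth_default // (negbTE infw) in xw.
  have lt_x : index x sg < size sg by rewrite index_mem.
  have Usg : uniq sg by move: Usb; rewrite cat_uniq => /andP[].
  rewrite eqSS; apply/eqP/eqP => [xi|xa]; first by rewrite /a -xi nth_index.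
  rewrite xa /a index_uniq //; case: (ltnP i (size sg)) => // ge_i.
  by rewrite xa /a nth_default // (negbTE infw) in xw.
have le_rp : r <= p by apply: rank_le_mono; apply: ltnW; apply: lt_ab.
have le_p : p <= size (filter (mem S) w).
  by rewrite size_filter -[in leqRHS](cat_take_drop (index a w) w) count_cat leq_addr.
have seqE : map fst (take p (chain S)) = take p (filter (mem S) w).
  by rewrite /chain -map_take -map_comp map_id.
have -> : insert_step (ltw w) (chain S, c) (i.+1, b) =
   (let r := binpos (ltw w) p b (take p (filter (mem S) w)) in
   (take r.1 (chain S) ++ (b, 0) :: drop r.1 (chain S), c + r.2)).
  by rewrite /insert_step findE seqE.
have szp : size (take p (filter (mem S) w)) = p by rewrite size_takel.
rewrite (@binposE _ _ inf p b _ r) ?szp //=; last first.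
  move=> j lt_jp; rewrite nth_take // /ltw rank_nth //.
  by rewrite -size_filter (leq_trans lt_jp).
congr (_, _); rewrite /chain -map_take -map_drop.
have -> : (b, 0) = (b, tag b).
  rewrite /tag ifN //; move: Usb; rewrite cat_uniq => /and3P[_ /hasPn + _].
  by apply; apply: mem_nth.
rewrite -map_cons -map_cat; congr map.
exact: filter_insert_rank.
Qed.

(* The main chain just before the insertion of the [i]-th element of the group
   [u+1, ..., M]. *)
Definition group_set u i M :=
  sg ++ [seq beta j | j <- iota 1 u] ++ [seq beta j | j <- iota i.+1 (M - i)].

Lemma betaP i j : 0 < i <= m -> 0 < j <= m -> (beta i == beta j) = (i == j).
Proof.
clear w Uw infw wE sgE lt_ab sz_bs; move=> hi hj; rewrite nth_uniq; [|lia|lia|].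
  by case: i j hi hj => [|i] [|j].
by move: Usb; rewrite cat_uniq => /and3P[].
Qed.

Lemma beta_sg i : 0 < i <= m -> beta i \notin sg.
Proof.
clear w Uw infw wE sgE lt_ab sz_bs; move=> hi; move: Usb; rewrite cat_uniq => /and3P[_ /hasPn + _].
by apply; apply: mem_nth; lia.
Qed.

Lemma mem_beta_map i s : 0 < i <= m -> all (fun j => 0 < j <= m) s ->
  (beta i \in [seq beta j | j <- s]) = (i \in s).
Proof.
move=> hi /allP hs; apply/mapP/idP => [[j js /eqP]|]; last by exists i.
by rewrite betaP //; [move=> /eqP-> | exact: hs].
Qed.

Lemma all_iota a n : 0 < a -> a + n <= m.+1 -> all (fun j => 0 < j <= m) (iota a n).
Proof. by clear; move=> *; apply/allP => j; rewrite mem_iota; lia. Qed.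

(** Indices run downwards within a group: after [d] insertions those above [M - d] are present. *)
Lemma fold_group u M c d : 0 < u -> u <= M -> M <= m -> d <= M - u ->
  foldl (insert_step (ltw w)) (chain (group_set u M M), c)
    [seq (i, beta i) | i <- rev (iota (M - d).+1 d)] =
  (chain (group_set u (M - d) M),
   c + \sum_(i <- rev (iota (M - d).+1 d)) step_cost (group_set u i M) i).
Proof.
move=> u0 uM Mm; elim: d => [|d IH] le_d; first by rewrite subn0 /= big_nil addn0.
have Ed : (M - d.+1).+1 = M - d by lia.
rewrite [iota _ _]/= Ed rev_cons map_rcons -cats1 foldl_cat IH; last lia.
rewrite -cats1 big_cat big_seq1 addnA; cbn [foldl].
have hi : 0 < M - d <= m by lia.
rewrite insert_stepE //.
- congr (_, _); apply: eq_chain => x; rewrite /group_set Ed inE !mem_cat.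
  have -> : M - (M - d.+1) = (M - (M - d)).+1 by lia.
  by rewrite [map _ (iota _ _.+1)]/= inE; do !case: (_ \in _); rewrite ?orbT ?orbF.
- by move=> x xs; rewrite mem_cat xs.
rewrite !mem_cat negb_or beta_sg //= negb_or !mem_beta_map ?all_iota //; try lia.
by rewrite !mem_iota; lia.
Qed.

Definition insertion_cost :=
  \sum_(k <- iota 2 m) \sum_(i <- group k m)
     step_cost (group_set (tJ k.-1) i (minn (tJ k) m)) i.

Lemma fold_groups c K : 0 < m ->
  foldl (insert_step (ltw w)) (chain (group_set 1 1 1), c)
    [seq (i, beta i) | i <- flatten [seq group k m | k <- iota 2 K]] =
  (chain (sg ++ [seq beta j | j <- iota 1 (minn (tJ K.+1) m)]),
   c + \sum_(k <- iota 2 K) \sum_(i <- group k m)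
     step_cost (group_set (tJ k.-1) i (minn (tJ k) m)) i).
Proof.
move=> m0; elim: K => [|K IH].
  by rewrite big_nil addn0 (minn_idPl _) // /group_set subnn cats0.
have -> : iota 2 K.+1 = rcons (iota 2 K) K.+2.
  by rewrite -(addn1 K) iotaD -cats1 /= ?addn1 ?add2n.
rewrite map_rcons -cats1 flatten_cat map_cat foldl_cat IH /= cats0.
rewrite -cats1 big_cat big_seq1 /= addnA.
set c' := c + _; rewrite /group /=; set u := tJ K.+1.
have [le_mu|lt_um] := leqP m u.
  have le_mu' : m <= tJ K.+2 by apply: leq_trans le_mu (leq_tJS _).
  by rewrite !(minn_idPr _) // (_ : m - u = 0) ?big_nil ?addn0 //; lia.
set M := minn (tJ K.+2) m; have uM : u <= M by rewrite leq_min leq_tJS ltnW.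
have Mm : M <= m by rewrite geq_minr.
have := @fold_group u M c' (M - u) (tJ_gt0 _) uM Mm (leqnn _).
rewrite subKn //; rewrite {1}/group_set subnn cats0 => ->.
congr (_, _); apply: eq_chain => x; rewrite /group_set; congr (x \in _ ++ _).
by rewrite -map_cat -{1}[u.+1]add1n -iotaD subnKC.
Qed.

Lemma fold_insertion_order c : 0 < m ->
  foldl (insert_step (ltw w)) (chain (rcons sg (beta 1)), c)
    [seq (i, beta i) | i <- insertion_order m] =
  ([seq (x, tag x) | x <- w], c + insertion_cost).
Proof.
move=> m0; rewrite insertion_orderE.
have -> : chain (rcons sg (beta 1)) = chain (group_set 1 1 1).
  by apply: eq_chain => x; rewrite /group_set cats0 cats1.
(* The groups 2 to [m + 1] reach every index, because [m <= tJ m.+1]. *)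
rewrite fold_groups // (minn_idPr (leq_tJ _)); congr (_, _).
rewrite /chain; congr map; apply/all_filterP/allP => x; rewrite wE.
rewrite !mem_cat; case: (x \in sg) => //= xb.
rewrite (_ : map _ _ = bs) //; apply: (@eq_from_nth _ inf); rewrite size_map size_iota //.
by move=> i lt_i; rewrite (nth_map 0) ?size_iota // nth_iota.
Qed.

Lemma chain_init : 0 < m -> 0 < size sg ->
  chain (rcons sg (beta 1)) = (beta 1, 0) :: zip sg (iota 1 (size sg)).
Proof.
move=> m0 s0; have b_w : beta 1 \in w by rewrite wE mem_cat mem_nth ?orbT.
have b_sg : beta 1 \notin sg by apply: beta_sg.
have Usg : uniq sg by move: Usb; rewrite cat_uniq => /andP[].
(* [beta 1] lies below the least element of [sg], hence enters the chain in front without a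
   comparison. *)
have r0 : rank (mem sg) w (beta 1) = 0.
  apply/eqP; rewrite -leqn0.
  apply: leq_trans (rank_le_mono (mem sg) (ltnW (lt_ab m0))) _.
  rewrite -index_filter ?sgE => [|_]; last exact: mem_nth.
  by rewrite index_uniq.
rewrite /chain (eq_filter (a2 := predU1 (beta 1) (mem sg))) => [|x]; last first.
  by rewrite /= mem_rcons inE.
rewrite -filter_insert_rank // r0 take0 drop0 sgE /= /tag (negbTE b_sg); congr (_ :: _).
apply: (@eq_from_nth _ (inf, 0)); first by rewrite size_map size_zip size_iota minnn.
move=> i; rewrite size_map => lt_i.
by rewrite (nth_map inf) // nth_zip ?size_iota // mem_nth // index_uniq // nth_iota.
Qed.

End InsertionPhase.

(** * One level of the recursion *)

Lemma size_pairup (T : Type) (lt : T -> T -> bool) s : size (pairup lt s) = (size s)./2.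
Proof.
have [n] := ubnP (size s); elim: n s => // n IH [|x [|y s]] //= le_n.
by rewrite IH //; lia.
Qed.

Lemma mi_fuel f f' (T : Type) (lt : T -> T -> bool) s :
  size s <= f -> size s <= f' -> mi f lt s = mi f' lt s.
Proof.
elim: f f' T lt s => [|f IH] [|f'] T lt s le_f le_f' //=.
- by rewrite (leq_trans le_f).
- by rewrite (leq_trans le_f').
case: leqP => // lt_s.
rewrite (IH f') // size_pairup; lia.
Qed.

(** By [mi_map] both runs can be moved to the positions in [s], where the two relations agree
    everywhere. *)
Lemma mi_eq_in (T : eqType) (lt lt' : T -> T -> bool) fuel s :
  {in s &, lt =2 lt'} -> mi fuel lt s = mi fuel lt' s.
Proof.
move=> eq_lt; pose f := tnth (in_tuple s).
have sE : map f (enum 'I_(size s)) = s by rewrite map_tnth_enum.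
pose lt0 i j := lt (f i) (f j).
rewrite -[in LHS]sE -[in RHS]sE (@mi_map _ _ _ lt0) // (@mi_map _ _ _ lt0) // => i j.
by rewrite /lt0 eq_lt ?mem_tnth.
Qed.

Definition rest_of (T : Type) (s : seq T) := if odd (size s) then drop (size s).-1 s else [::].

Lemma rest_of_cons2 (T : Type) (x y : T) s : rest_of [:: x, y & s] = rest_of s.
Proof. by rewrite /rest_of /= negbK; case: s. Qed.

Lemma size_rest_of (T : Type) (s : seq T) : size (rest_of s) = odd (size s).
Proof.
by rewrite /rest_of; case: ifP => // odd_s; rewrite size_drop; case: s odd_s => //= x s _; lia.
Qed.

Section Level.
Variable T : eqType.
Implicit Types s w : seq T.

Lemma perm_pairup lt s :
  perm_eq (unzip1 (pairup lt s) ++ unzip2 (pairup lt s) ++ rest_of s) s.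
Proof.
have [n] := ubnP (size s); elim: n s => // n IH [|x [|y s]] // le_n.
have {}IH : perm_eq (unzip1 (pairup lt s) ++ unzip2 (pairup lt s) ++ rest_of s) s.
  by apply: IH; move: le_n => /=; lia.
rewrite rest_of_cons2 /=; set A := pairup lt s in IH *.
have perm2 (a b : T) : perm_eq ((a :: unzip1 A) ++ (b :: unzip2 A) ++ rest_of s) [:: a, b & s].
  rewrite cat_cons perm_cons -[b :: s]cat1s -[(_ :: _) ++ _]cat1s perm_catCA.
  by rewrite perm_cat2l.
case: (lt x y) => //=; last exact: perm2.
apply: perm_trans (perm2 _ _) _.
by rewrite -[[:: y, x & s]]/([:: y] ++ [:: x] ++ s) perm_catCA.
Qed.

Lemma pairup_ltw w s : uniq s -> {subset s <= w} ->
  all (fun p => ltw w p.2 p.1) (pairup (ltw w) s).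
Proof.
have [n] := ubnP (size s); elim: n s => // n IH [|x [|y s]] // le_n Us sw.
rewrite /= IH; last 1 first.
- by move=> z zs; apply: sw; rewrite !inE zs !orbT.
- rewrite andbT; case: ifP => //= /negbT; rewrite /ltw -leqNgt leq_eqVlt.
  case/orP=> // /eqP eqi; have yw : y \in w by apply: sw; rewrite !inE eqxx orbT.
  have xw : x \in w by apply: sw; rewrite mem_head.
  by move: Us; rewrite /= -[x](nth_index x xw) -eqi nth_index // mem_head.
- by move: le_n => /=; lia.
by case/and3P: Us.
Qed.

Definition winners w s := unzip1 (pairup (ltw w) s).
Definition losers w s := unzip2 (pairup (ltw w) s).
Definition main_chain w s := filter (mem (winners w s)) w.
Definition partner inf w s x := nth inf (losers w s) (index x (winners w s)).
Definition small_elts inf w s := map (partner inf w s) (main_chain w s) ++ rest_of s.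

Section OneLevel.
Variables (inf : T) (w s : seq T).
Hypotheses (Us : uniq s) (infs : inf \notin s) (pw : perm_eq w s).

Let A := pairup (ltw w) s.
Let aa := winners w s.
Let bb := losers w s.
Let sg := main_chain w s.
Let bs := small_elts inf w s.

Lemma uniq_parts : uniq (aa ++ bb ++ rest_of s).
Proof. by rewrite (perm_uniq (perm_pairup _ _)). Qed.

Lemma uniq_winners : uniq aa.
Proof. by move: uniq_parts; rewrite cat_uniq => /andP[]. Qed.

Lemma size_winners : size aa = (size s)./2.
Proof. by rewrite /aa /winners size_map size_pairup. Qed.

Lemma perm_main_chain : perm_eq sg aa.
Proof.
apply: uniq_perm; [by rewrite filter_uniq // (perm_uniq pw)|exact: uniq_winners|].
move=> x; rewrite mem_filter /=; apply: andb_idr => xa.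
by rewrite (perm_mem pw) -(perm_mem (perm_pairup (ltw w) s)) mem_cat xa.
Qed.

Lemma size_main_chain : size sg = (size s)./2.
Proof. by rewrite (perm_size perm_main_chain) size_winners. Qed.

Lemma size_small_elts : size bs = uphalf (size s).
Proof.
by rewrite size_cat size_map size_main_chain size_rest_of uphalf_half addnC.
Qed.

Lemma partner_winners : map (partner inf w s) aa = bb.
Proof.
apply: (@eq_from_nth _ inf); first by rewrite size_map /aa /bb /winners /losers !size_map.
move=> i; rewrite size_map => lt_i.
by rewrite (nth_map inf) // /partner index_uniq // uniq_winners.
Qed.

Lemma pairupE : A = [seq (x, partner inf w s x) | x <- aa].
Proof.
rewrite -[LHS]zip_unzip -/(winners w s) -/(losers w s) -/aa -/bb -partner_winners.
by elim: aa => //= x l ->.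
Qed.

Lemma perm_small_elts : perm_eq bs (bb ++ rest_of s).
Proof.
by rewrite perm_cat2r -partner_winners; apply: perm_map; apply: perm_main_chain.
Qed.

Lemma perm_level : perm_eq (sg ++ bs) s.
Proof.
apply: perm_trans (perm_pairup (ltw w) s).
exact: perm_cat perm_main_chain perm_small_elts.
Qed.

Lemma lt_partner x : x \in aa -> index (partner inf w s x) w < index x w.
Proof.
move=> xa; have : (x, partner inf w s x) \in A by rewrite pairupE map_f.
have sub : {subset s <= w} by move=> y; rewrite (perm_mem pw).
by move/(allP (pairup_ltw Us sub)).
Qed.

Lemma lt_small_elts i : i < size bs -> index (nth inf bs i) w < index (nth inf sg i) w.
Proof.
move=> lt_i; have [lt_is|ge_is] := ltnP i (size sg).
  rewrite nth_cat size_map lt_is (nth_map inf) //.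
  by apply: lt_partner; rewrite -(perm_mem perm_main_chain) mem_nth.
rewrite [X in _ < index X w]nth_default //.
have -> : index inf w = size w by apply/memNindex; rewrite (perm_mem pw).
by rewrite index_mem (perm_mem pw) -(perm_mem perm_level) mem_cat mem_nth ?orbT.
Qed.

Lemma main_chainE : filter (mem sg) w = sg.
Proof. by apply: eq_filter => x; rewrite /= (perm_mem perm_main_chain). Qed.

Lemma mi_level_eq fuel : 1 < size s -> (mi fuel (ltw sg) aa).1 = sg ->
  mi fuel.+1 (ltw w) s =
  (w, (size s)./2 + (mi fuel (ltw sg) aa).2 + insertion_cost inf w sg bs).
Proof.
move=> s_gt1 IH.
have infw : inf \notin w by rewrite (perm_mem pw).
have Uw : uniq w by rewrite (perm_uniq pw).
have wE : w =i sg ++ bs by move=> x; rewrite (perm_mem pw) (perm_mem perm_level).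
have Usb : uniq (sg ++ bs) by rewrite (perm_uniq perm_level).
have szb : size bs <= (size sg).+1.
  by rewrite size_small_elts size_main_chain uphalf_half; case: odd.
have sg0 : 0 < size sg by rewrite size_main_chain; lia.
have bs0 : 0 < size bs by rewrite size_small_elts uphalf_half; lia.
rewrite /= leqNgt s_gt1 /= -/A -/(rest_of s).
(* A pair is determined by its winner, so the recursive call on pairs is the image of a call on the
   winners, on which the orders of [w] and [sg] agree. *)
have miA : mi fuel (fun p q : T * T => ltw w p.1 q.1) A =
    ([seq (x, partner inf w s x) | x <- sg], (mi fuel (ltw sg) aa).2).
  rewrite pairupE (@mi_map _ _ _ (ltw w)) //.
  rewrite (@mi_eq_in _ (ltw w) (ltw sg)) ?IH // => x y xa ya.
  by rewrite /ltw index_filter_lt.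
rewrite miA /=; set bs' := _ ++ rest_of s.
have {bs'}-> : bs' = bs by rewrite /bs' -map_comp.
set ch0 := match _ with [::] => _ | _ => _ end.
have ch0E : ch0 = chain w sg (rcons sg (nth inf bs 0)).
  rewrite (@chain_init _ inf w sg bs) //; [|exact: main_chainE|exact: lt_small_elts].
  rewrite /ch0 /bs /small_elts -/sg; case: (sg) sg0 => //= x l _.
  by rewrite -map_comp map_id size_map.
have todoE : pmap (fun i => omap [eta pair i] (onth bs i.-1)) (insertion_order (size bs)) =
    [seq (i, nth inf bs i.-1) | i <- insertion_order (size bs)].
  have : all (fun i => i.-1 < size bs) (insertion_order (size bs)).
    apply/allP => i; rewrite insertion_orderE => /flatten_mapP[k _].
    by rewrite mem_group; lia.
  elim: (insertion_order _) => //= i l IHl /andP[lt_i /IHl ->].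
  by rewrite onthE (nth_map inf).
rewrite todoE ch0E (@fold_insertion_order _ inf w sg bs) //;
  last exact: lt_small_elts.
by rewrite /= -map_comp map_id add0n size_pairup.
Qed.

End OneLevel.

(** The premise of [mi_level_eq] on the recursive call is the induction hypothesis for the
    winners. *)
Lemma mi_sorted fuel inf w s : uniq s -> inf \notin s -> perm_eq w s -> size s <= fuel ->
  (mi fuel (ltw w) s).1 = w.
Proof.
elim: fuel w s => [|fuel IH] w s Us infs pw le_s.
  by case: s le_s pw {Us infs} => // _; case: w => // x w /perm_size.
have [s_gt1|s_le1] := ltnP 1 (size s).
  rewrite (@mi_level_eq inf) // IH //.
  - exact: uniq_winners.
  - apply: contra infs => infa.
    by rewrite -(perm_mem (perm_pairup (ltw w) s)) mem_cat infa.
  - exact: perm_main_chain.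
  - by rewrite size_winners; lia.
rewrite /= s_le1; case: s s_le1 pw {Us infs le_s} => [|x [|y s]] //= _.
  by case: w => // x w /perm_size.
by move=> pw; rewrite (perm_small_eq _ pw).
Qed.

Lemma mi_levelE inf w s : uniq s -> inf \notin s -> perm_eq w s -> 1 < size s ->
  (mi (size s) (ltw w) s).2 =
  (size s)./2 + (mi (size s)./2 (ltw (main_chain w s)) (winners w s)).2 +
  insertion_cost inf w (main_chain w s) (small_elts inf w s).
Proof.
move=> Us infs pw s_gt1; have szE : size s = (size s).-1.+1 by lia.
rewrite [X in mi X _ s]szE (@mi_level_eq inf) //=.
  by rewrite (@mi_fuel _ (size s)./2) // size_winners; lia.
apply: (@mi_sorted _ inf).
- exact: uniq_winners.
- apply: contra infs => infa.
  by rewrite -(perm_mem (perm_pairup (ltw w) s)) mem_cat infa.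
- exact: perm_main_chain.
- by rewrite size_winners; lia.
Qed.

End Level.

(** * Averaging *)

(** Conditioning on the word without the letters of [ys] again leaves a space of insertions, of [ys]
    alone: by [mem_ext] the order of insertion is immaterial, and the constraints on the other
    letters can be read off the remainder [Z]. *)
Lemma ext_fiber (T : eqType) (xs ys : seq (T * T)) sg w0 :
    ext_wf xs sg -> w0 \in ext xs sg -> {subset ys <= xs} -> uniq (unzip1 ys) ->
  let Z := filter [predC unzip1 ys] w0 in
  ext_wf ys Z /\
  (forall w, (w \in ext xs sg) && (filter [predC unzip1 ys] w == Z) = (w \in ext ys Z)).
Proof.
move=> wf w0E sub Uy Z; move: (w0E); rewrite mem_ext // => /and3P[pw0 /eqP fw0 aw0].
have Uw0 : uniq w0 by rewrite (perm_uniq pw0); case/andP: wf.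
have Ux : uniq (unzip1 xs) by case/andP: wf; rewrite cat_uniq => /andP[].
have sub1 : {subset unzip1 ys <= unzip1 xs}.
  by move=> _ /mapP[p yp ->]; rewrite map_f // sub.
have bound p : p \in xs -> p.2 \notin unzip1 ys.
  move=> xp; case/andP: wf => _ /allP/(_ _ xp); apply: contra; exact: sub1.
have subw0 : {subset unzip1 ys <= w0}.
  by move=> x yx; rewrite (perm_mem pw0) mem_cat sub1.
have wf' : ext_wf ys Z.
  apply/andP; split; last by apply/allP => p /sub; apply: bound.
  rewrite cat_uniq Uy filter_uniq // andbT; apply/hasPn => x.
  by rewrite mem_filter => /andP[].
have pZ : perm_eq (unzip1 ys ++ Z) w0.
  apply: uniq_perm => //; first by case/andP: wf'.
  move=> x; rewrite mem_cat mem_filter /= -[x \in map _ _]/(x \in unzip1 ys).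
  by case: (boolP (x \in unzip1 ys)) => //= /subw0.
split=> // w; rewrite !mem_ext //.
apply/andP/and3P => [[/and3P[pw fw aw] /eqP fZ]|[pw /eqP fZ aw]].
  split; [|exact/eqP|by apply/allP => p /sub; apply: (allP aw)].
  by rewrite (permPl pw) -(permPl pw0) perm_sym.
rewrite fZ eqxx; split=> //.
have pww0 : perm_eq w w0 by rewrite (permPl pw).
have filt v : filter [predC unzip1 xs] v = filter [predC unzip1 xs] (filter [predC unzip1 ys] v).
  rewrite -filter_predI; apply: eq_filter => x /=.
  by case: (boolP (x \in unzip1 ys)) => [/sub1 ->|_]; rewrite ?andbT.
apply/and3P; split; first by rewrite (permPl pww0).
  by rewrite filt fZ /Z -filt fw0.
apply/allP => -[x a] xp; case: (boolP (x \in unzip1 ys)) => [/mapP[[y b] yp /= xy]|xN].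
  (* First components are distinct in [xs], so the pair of [xs] with this letter is the one in
     [ys]. *)
  suff E : (x, a) = (y, b) by move: (allP aw _ yp); rewrite -E.
  have [i lt_i iE] := nthP (x, a) xp; have [j lt_j jE] := nthP (x, a) (sub _ yp).
  rewrite -iE -jE; congr nth; apply/eqP.
  rewrite -(nth_uniq x _ _ Ux) ?size_map // !(nth_map (x, a)) // iE jE.
  exact/eqP.
rewrite -(@index_filter_lt _ [predC unzip1 ys]) //=; last exact: bound xp.
rewrite fZ index_filter_lt //=; last exact: bound xp.
exact: (allP aw0 _ xp).
Qed.

Section RankBounds.
Variables (T : eqType).
Implicit Types (w S : seq T).

Lemma rank_le_size w S a L : uniq w ->
    (forall x, x \in w -> x \in S -> index x w < index a w -> x \in L)%N ->
  (rank (mem S) w a <= size L)%N.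
Proof.
move=> Uw sub; rewrite /rank -size_filter; apply: uniq_leq_size.
  by rewrite filter_uniq // take_uniq.
move=> x; rewrite mem_filter => /andP[/= xS xt]; have xw := mem_take xt.
by apply: sub => //; rewrite in_take_leq ?index_size // in xt.
Qed.

Lemma rank_ge_size w S a L : uniq L ->
    (forall x, x \in L -> (x \in S) && (index x w < index a w))%N ->
  (size L <= rank (mem S) w a)%N.
Proof.
move=> UL sub; rewrite /rank -size_filter; apply: uniq_leq_size => // x xL.
have /andP[xS lt_x] := sub x xL.
by rewrite mem_filter /= xS in_take_leq ?index_size.
Qed.

End RankBounds.

Section Omega.
Variables (T : eqType) (inf : T) (sg bs : seq T).
Hypothesis Usb : uniq (sg ++ bs).
Hypothesis inf_sb : inf \notin sg ++ bs.
Hypothesis sz_bs : size sg <= size bs <= (size sg).+1.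

Local Notation alpha i := (nth inf sg i.-1).
Local Notation beta i := (nth inf bs i.-1).
Local Notation m := (size bs).

(* The unpaired element, if any, is the last [beta], and its bound [alpha] is the
   default value [inf], which occurs in no word. *)
Definition insertions i n := [seq (beta j, alpha j) | j <- iota i n].
(** The words with given main chain and pairing, see [mem_fiber_omega]. The order 1 to [m] only
    serves to enumerate them; the order of the algorithm enters through [group_set]. *)
Definition omega := ext (insertions 1 m) sg.

Lemma unzip1_insertions i n : unzip1 (insertions i n) = [seq beta j | j <- iota i n].
Proof. by rewrite /unzip1 -map_comp. Qed.

Lemma unzip1_all : unzip1 (insertions 1 m) = bs.
Proof.
rewrite unzip1_insertions; apply: (@eq_from_nth _ inf); rewrite size_map size_iota //.
by move=> i lt_i; rewrite (nth_map 0) ?size_iota // nth_iota.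
Qed.

Lemma alpha_notin i : 0 < i -> alpha i \notin bs.
Proof.
move: Usb inf_sb; rewrite cat_uniq mem_cat negb_or => /and3P[_ /hasPn dis _] /andP[_ iN] i0.
case: (ltnP i.-1 (size sg)) => [lt_i|ge_i]; last by rewrite nth_default.
by apply: contraTN (mem_nth inf lt_i) => /dis.
Qed.

Lemma sub_insertions i n : 0 < i -> i + n <= m.+1 ->
  {subset insertions i n <= insertions 1 m}.
Proof.
clear Usb inf_sb sz_bs; move=> i0 le_in p /mapP[j]; rewrite mem_iota => j_in ->.
by apply: map_f; rewrite mem_iota; lia.
Qed.

Lemma omega_wf : ext_wf (insertions 1 m) sg.
Proof.
rewrite /ext_wf unzip1_all uniq_catC Usb; apply/allP => _ /mapP[j + ->] /=.
by rewrite mem_iota => /andP[j0 _]; apply: alpha_notin.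
Qed.

Lemma omegaP w : w \in omega ->
  [/\ perm_eq w (sg ++ bs), filter (mem sg) w = sg &
      forall i, 0 < i <= m -> index (beta i) w < index (alpha i) w].
Proof.
rewrite mem_ext ?omega_wf // unzip1_all => /and3P[pw /eqP fw aw].
have pw' : perm_eq w (sg ++ bs) by rewrite (permPl pw) perm_catC.
split=> //.
  rewrite -[RHS]fw; apply: eq_in_filter => x; rewrite (perm_mem pw') mem_cat /=.
  case: (boolP (x \in sg)) => [xs _|_ /= ->] //; apply/esym.
  by move: Usb; rewrite cat_uniq => /and3P[_ /hasPn dis _]; apply: contraTN xs => /dis.
move=> i i_in; apply: (allP aw (beta i, alpha i)).
by apply: (map_f (fun j => (beta j, alpha j))); rewrite mem_iota; lia.
Qed.

Section OneWord.
Variable w : seq T.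
Hypothesis wO : w \in omega.

Lemma word_uniq : uniq w.
Proof. by have [/perm_uniq->] := omegaP wO. Qed.

Lemma inf_notin_word : inf \notin w.
Proof. by have [/perm_mem->] := omegaP wO. Qed.

Lemma index_alpha i j : 0 < i -> i <= j -> index (alpha i) w <= index (alpha j) w.
Proof.
move=> i0 le_ij; have [_ fw _] := omegaP wO.
case: (ltnP j.-1 (size sg)) => [lt_j|ge_j]; last first.
  rewrite [X in _ <= index X w]nth_default //.
  by rewrite (memNindex inf_notin_word) index_size.
have Usg : uniq sg by move: Usb; rewrite cat_uniq => /andP[].
have lt_i : i.-1 < size sg by lia.
rewrite leqNgt -(@index_filter_lt _ (mem sg)) /= ?mem_nth // fw.
by rewrite !index_uniq // -leqNgt; lia.
Qed.

Lemma index_before_alpha x i : x \in sg -> 0 < i ->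
  (index x w < index (alpha i) w) -> x \in take i.-1 sg.
Proof.
move=> xs i0 lt_x; have [_ fw _] := omegaP wO.
case: (ltnP i.-1 (size sg)) => [lt_i|ge_i]; last by rewrite take_oversize.
have Usg : uniq sg by move: Usb; rewrite cat_uniq => /andP[].
move: lt_x; rewrite -(@index_filter_lt _ (mem sg)) /= ?mem_nth // fw.
by rewrite index_uniq // in_take.
Qed.

(** Below [alpha i] there are at most [i - 1] elements of [sg], the first [u] small elements and the
    [M - i] already inserted ones of the group. *)
Lemma rank_group_le u i M : 0 < i <= M ->
  rank (mem (group_set inf sg bs u i M)) w (alpha i) < u + M.
Proof.
move=> hi; have := @rank_le_size _ w (group_set inf sg bs u i M) (alpha i)
  (take i.-1 sg ++ [seq beta j | j <- iota 1 u] ++ [seq beta j | j <- iota i.+1 (M - i)])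
  word_uniq.
rewrite !size_cat !size_map !size_iota size_take => H.
have {}H := H _; apply: leq_ltn_trans (H _) _; last by case: ifP; lia.
move=> x _; rewrite !mem_cat => /orP[xs /index_before_alpha->|->] //; first by case/andP: hi.
by rewrite orbT.
Qed.

(** The first [u] elements of [sg] and their partners all lie below [alpha j]. This keeps the search
    range long enough for the prefix error to be small per slot. *)
Lemma rank_group_ge u i M j : u < j <= m -> u <= size sg ->
  u.*2 <= rank (mem (group_set inf sg bs u i M)) w (alpha j).
Proof.
move=> hj le_u; have [pw fw lt_ab] := omegaP wO.
have -> : u.*2 = size (take u sg ++ [seq beta j | j <- iota 1 u]).
  by rewrite size_cat size_takel // size_map size_iota addnn.
have Usg : uniq sg by move: Usb; rewrite cat_uniq => /andP[].
have subb : {subset [seq beta j | j <- iota 1 u] <= bs}.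
  by move=> _ /mapP[l + ->]; rewrite mem_iota => hl; apply: mem_nth; lia.
apply: rank_ge_size.
  rewrite cat_uniq take_uniq //=; apply/andP; split.
    apply/hasPn => x /subb; move: Usb; rewrite cat_uniq => /and3P[_ /hasPn dis _] /dis.
    by apply: contra; apply: mem_take.
  rewrite map_inj_in_uniq ?iota_uniq // => l l'; rewrite !mem_iota => hl hl' /eqP.
  by rewrite (@betaP _ inf sg bs) //; [move/eqP|lia|lia].
have alpha_lt l : 0 < l <= u -> index (alpha l) w < index (alpha j) w.
  move=> hl; rewrite ltn_neqAle index_alpha ?andbT; [|lia|lia].
  apply/eqP => eqi; have lw : alpha l \in w.
    by rewrite (perm_mem pw) mem_cat mem_nth //; lia.
  have jw : alpha j \in w by rewrite -index_mem -eqi index_mem.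
  have : alpha l = alpha j by rewrite -(nth_index inf lw) eqi nth_index.
  have lt_j : j.-1 < size sg.
    rewrite ltnNge; apply: contraL jw => ge_j.
    by rewrite nth_default ?inf_notin_word.
  by move/eqP; rewrite nth_uniq //; lia.
move=> x; rewrite mem_cat => /orP[xt|xb].
  rewrite mem_cat (mem_take xt) /=.
  have [l lt_l <-] := nthP inf xt; rewrite size_takel // in lt_l.
  by rewrite nth_take //; apply: (alpha_lt l.+1); lia.
rewrite !mem_cat xb orbT /=; case/mapP: xb => l; rewrite mem_iota => hl ->.
apply: ltn_trans (lt_ab l _) (alpha_lt l _); lia.
Qed.

End OneWord.
End Omega.

Section OmegaAverage.
Variables (F : realFieldType) (T : eqType) (inf : T) (sg bs : seq T).
Hypothesis Usb : uniq (sg ++ bs).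
Hypothesis inf_sb : inf \notin sg ++ bs.
Hypothesis sz_bs : size sg <= size bs <= (size sg).+1.

Local Notation alpha i := (nth inf sg i.-1).
Local Notation beta i := (nth inf bs i.-1).
Local Notation m := (size bs).
Local Notation omega := (omega inf sg bs).

Lemma insertions_rcons i n :
  insertions inf sg bs i n.+1 =
  rcons (insertions inf sg bs i n) (beta (i + n), alpha (i + n)).
Proof. by rewrite /insertions -[n.+1]addn1 iotaD map_cat cats1. Qed.

Lemma uniq_unzip1_insertions i n : 0 < i -> i + n <= m.+1 ->
  uniq (unzip1 (insertions inf sg bs i n)).
Proof.
move=> i0 le_in; rewrite unzip1_insertions map_inj_in_uniq ?iota_uniq // => j l.
rewrite !mem_iota => hj hl /eqP; rewrite (@betaP _ inf sg bs) //; [move/eqP|lia|lia] => //.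
Qed.

Lemma insertions_wf n : n <= m -> ext_wf (insertions inf sg bs 1 n) sg.
Proof.
move=> le_n; have := omega_wf Usb inf_sb; case/andP=> Ux /allP ax.
have sub := @sub_insertions _ inf sg bs 1 n isT le_n.
have sub1 : {subset unzip1 (insertions inf sg bs 1 n) <= unzip1 (insertions inf sg bs 1 m)}.
  by move=> _ /mapP[p /sub xp ->]; apply: map_f.
apply/andP; split.
  move: Ux; rewrite !cat_uniq => /and3P[_ /hasPn dis ->].
  rewrite uniq_unzip1_insertions //= andbT; apply/hasPn => x /dis.
  by apply: contra; apply: sub1.
by apply/allP => p /sub /ax; apply: contra; apply: sub1.
Qed.

Lemma index_alpha_sg i : 0 < i <= (size sg).+1 -> index (alpha i) sg = i.-1.
Proof.
move=> hi; case: (ltnP i.-1 (size sg)) => [lt_i|ge_i].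
  by rewrite index_uniq //; move: Usb; rewrite cat_uniq => /andP[].
rewrite nth_default // memNindex; first lia.
by move: inf_sb; rewrite mem_cat negb_or => /andP[].
Qed.

(** Below the [i]-th bound lie [i - 1] elements of [sg] and the [i - 1] earlier insertions, leaving
    [2 i - 1] slots. The product depends only on [n], so the fibers over main chains have equal
    size. *)
Lemma size_ext_insertions n : n <= m ->
  size (ext (insertions inf sg bs 1 n) sg) = \prod_(i < n) i.*2.+1.
Proof.
elim: n => [|n IH] lt_n; first by rewrite big_ord0.
have wf := insertions_wf lt_n.
rewrite big_ord_recr /= -IH ?(ltnW lt_n) // insertions_rcons size_ext_rcons.
- rewrite size_map size_iota index_alpha_sg; first by congr (_ * _); lia.
  lia.
- by rewrite -insertions_rcons.
rewrite -insertions_rcons /sorted_bounds /insertions pairwise_map.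
apply/(pairwiseP 0) => j l; rewrite !inE size_iota => lt_j lt_l lt_jl.
rewrite !nth_iota //= (@index_alpha_sg j.+1) ?(@index_alpha_sg l.+1) /=; lia.
Qed.

Lemma size_omega : size omega = \prod_(i < m) i.*2.+1.
Proof. exact: size_ext_insertions. Qed.

Lemma omega_uniq : uniq omega.
Proof. by apply: ext_uniq; apply: omega_wf. Qed.

Local Open Scope ring_scope.

(** In the last group a search has at most [tJ k.-1 + n] slots; the second summand spreads the
    prefix error [k] over at least [tJ k.-1] slots. *)
Definition step_bound (k n : nat) : F :=
  if (tJ k < n)%N then k%:R else avg_depth F k (tJ k.-1 + n) + k%:R / (tJ k.-1)%:R.

Definition level_bound (n : nat) : F :=
  \sum_(k <- iota 2 n) \sum_(i <- group k n) step_bound k n.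

Lemma avg_depth_mono k N N' : (0 < N)%N -> (N <= N')%N -> avg_depth F k N <= avg_depth F k N'.
Proof.
move=> N0 le_N; rewrite /avg_depth lerD2l lerN2 ler_pM2l ?ltr0n ?expn_gt0 //.
by rewrite lef_pV2 ?posrE ?ltr0n ?(leq_trans N0) // ler_nat.
Qed.

Lemma step_avg k i : (0 < k)%N -> (tJ k.-1 < i <= minn (tJ k) m)%N ->
  \sum_(w <- omega) (step_cost inf w sg bs (group_set inf sg bs (tJ k.-1) i (minn (tJ k) m)) i)%:R
    <= (size omega)%:R * step_bound k m.
Proof.
move=> k0 hi; set u := tJ k.-1 in hi *; have u0 : (0 < u)%N by apply: tJ_gt0.
have uk : (u + tJ k = 2 ^ k)%N by rewrite addnC -(prednK k0) tJS.
have uk' : (tJ k <= u.*2.+1)%N by rewrite -{1}(prednK k0) tJS_le.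
rewrite /step_bound; have [lt_km|le_mk] := ltnP (tJ k) m.
  have -> : (size omega)%:R * k%:R = \sum_(w <- omega) k%:R :> F.
    by rewrite big_const_seq count_predT iter_addr_0 mulr_natl.
  rewrite big_seq [leRHS]big_seq; apply: ler_sum => w wO; rewrite ler_nat.
  apply: slot_depth_le.
  have := @rank_group_le _ inf sg bs Usb inf_sb sz_bs w wO u i (tJ k).
  by rewrite uk; apply; lia.
have Mm : minn (tJ k) m = m by apply/minn_idPr.
rewrite Mm in hi; set S := group_set inf sg bs u i m.
pose n := (i - u.+1)%N; have iE : i = (u.+1 + n)%N by rewrite /n; lia.
(* The small elements from [u + 1] to [i - 1] are not yet in the chain when [beta i] is inserted.
   Listing [beta i] last makes it the last insertion into [Z]. *)
pose ys := insertions inf sg bs u.+1 n.+1.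
have ysE : ys = rcons (insertions inf sg bs u.+1 n) (beta i, alpha i).
  by rewrite /ys insertions_rcons -iE.
(* Averaging over the words with the same chain [Z] into which [beta i] is inserted. *)
pose key w := filter [predC unzip1 ys] w.
apply: (@sum_le_fibers _ _ _ key) => w0 w0O.
set Z := key w0.
have Uy : uniq (unzip1 ys) by apply: uniq_unzip1_insertions; lia.
have suby : {subset ys <= insertions inf sg bs 1 m} by apply: sub_insertions; lia.
have [wfy fibE] := ext_fiber (omega_wf Usb inf_sb) w0O suby Uy.
rewrite -/key -/Z in wfy fibE.
have p_fib : perm_eq (filter (fun w => key w == Z) omega) (ext ys Z).
  apply: uniq_perm; [by rewrite filter_uniq // omega_uniq|exact: ext_uniq|].
  by move=> w; rewrite mem_filter andbC -fibE.
rewrite -size_filter -big_filter (perm_big _ p_fib) (perm_size p_fib) /=.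
have yO w : w \in ext ys Z -> w \in omega by rewrite -fibE => /andP[].
have alphaN j : (0 < j)%N -> alpha j \notin unzip1 ys.
  move=> j0; have := @alpha_notin _ inf sg bs Usb inf_sb j j0; apply: contra.
  rewrite unzip1_insertions => /mapP[l + ->]; rewrite mem_iota => hl.
  by apply: mem_nth; lia.
(* On the whole fiber the chain of the algorithm just before this insertion is [Z]. *)
have SZ w : w \in ext ys Z -> {in w, mem S =1 mem Z}.
  move=> wE x xw; have wO := yO w wE.
  have keyZ : key w = Z by apply/eqP; move: wE; rewrite -fibE => /andP[].
  have [pw _ _] := omegaP Usb inf_sb sz_bs wO.
  rewrite -keyZ; change ((x \in S) = (x \in key w)); rewrite mem_filter xw andbT.
  change ((x \in S) = (x \notin unzip1 ys)); rewrite unzip1_insertions.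
  move: xw; rewrite (perm_mem pw) mem_cat => /orP[xs|/(nthP inf)[l lt_l <-]].
    rewrite mem_cat xs; apply/esym.
    move: Usb; rewrite cat_uniq => /and3P[_ /hasPn dis _].
    apply: contraTN xs => /mapP[j]; rewrite mem_iota => hj ->.
    by apply: dis; apply: mem_nth; lia.
  have hl : (0 < l.+1 <= m)%N by [].
  rewrite -[nth inf bs l]/(beta l.+1) /S !mem_cat (negbTE (beta_sg inf Usb hl)).
  rewrite !(mem_beta_map _ Usb) ?all_iota //; try lia.
  by rewrite !mem_iota; lia.
have rankS w x : w \in ext ys Z -> rank (mem S) w x = rank (mem Z) w x.
  by move=> wE; apply: eq_in_count => y /mem_take; apply: SZ.
have i0 : (0 < i)%N by lia.
pose z := index (alpha i) Z.
have zE w : w \in ext ys Z -> rank (mem S) w (alpha i) = z.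
  by move=> wE; rewrite rankS // (rank_ext wfy wE) // alphaN.
have w0Z : w0 \in ext ys Z by rewrite -fibE w0O eqxx.
have lt_z : (z < u + m)%N.
  by rewrite -(zE _ w0Z); apply: rank_group_le => //; lia.
have ge_zj j : (u < j <= m)%N -> (u.*2 <= index (alpha j) Z)%N.
  move=> hj; rewrite -(rank_ext wfy w0Z) -?rankS ?alphaN //; last lia.
  by apply: rank_group_ge => //; lia.
have ge_z : (u.*2 <= z)%N by apply: ge_zj; lia.
(* The search range has length [z] for every word of the fiber, so the cost is a function of the
   slot in [Z]. *)
pose g p : F := (slot_depth z z p)%:R.
rewrite (eq_big_seq (fun w => g (rank (mem Z) w (beta i)))) => [|w wE]; last first.
  by rewrite /step_cost !rankS // -rankS // zE.
(* Here [A = avg_depth F k (u + m)], [D = k] and [e = k / u]. *)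
rewrite ysE; apply: (@avg_ext_last_le _ _ g _ k%:R); rewrite -ysE //.
  rewrite /sorted_bounds /ys /insertions pairwise_map.
  apply/(pairwiseP 0%N) => j l; rewrite !inE size_iota => lt_j lt_l lt_jl.
  rewrite !nth_iota //=.
  rewrite -(rank_ext wfy w0Z (@alphaN (u.+1 + j)%N isT)).
  rewrite -(rank_ext wfy w0Z (@alphaN (u.+1 + l)%N isT)).
  apply: rank_le_mono; apply: (@index_alpha _ inf sg bs _ _ _ w0 _ (u.+1 + j)%N (u.+1 + l)%N) => //.
  by rewrite leq_add2l ltnW.
apply/allP => _ /mapP[j + ->]; rewrite mem_iota => hj /=.
have hj' : (u < j <= m)%N by lia.
have ge_j := ge_zj j hj'.
have le_jz : (index (alpha j) Z <= z)%N.
  rewrite /z -!(rank_ext wfy w0Z) ?alphaN //; last lia.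
  apply: rank_le_mono; apply: (@index_alpha _ inf sg bs _ _ _ w0 _ j i) => //; lia.
apply/andP; split.
  (* The tree has the right height because [2 u <= z < u + m <= 2^k <= 3 u + 1]. *)
  rewrite -natr_sum; apply: le_trans (@slot_depth_prefix F z z k _ _ _ _ _) _ => //; try lia.
  rewrite lerD2r ler_wpM2l // avg_depth_mono //.
by rewrite mulrA ler_pdivlMr ?ltr0n // mulrC ler_pM2r ?ltr0n // ler_nat; lia.
Qed.

Lemma insertion_avg :
  \sum_(w <- omega) (insertion_cost inf w sg bs)%:R <= (size omega)%:R * level_bound m.
Proof.
rewrite /level_bound mulr_sumr.
under eq_bigr => w _ do rewrite /insertion_cost natr_sum.
rewrite exchange_big big_seq [leRHS]big_seq; apply: ler_sum => k.
rewrite mem_iota => hk; rewrite mulr_sumr.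
under eq_bigr => w _ do rewrite natr_sum.
rewrite exchange_big big_seq [leRHS]big_seq; apply: ler_sum => i.
by rewrite mem_group => hi; apply: step_avg => //; lia.
Qed.

End OmegaAverage.

Lemma pairup_eq (T : eqType) lt0 (w s : seq T) :
  all (fun p => ltw w p.2 p.1) (pairup lt0 s) -> pairup (ltw w) s = pairup lt0 s.
Proof.
have [n] := ubnP (size s); elim: n s => // n IH [|x [|y s]] // le_n /andP[lt_p all_p].
rewrite /= IH //; last by move: le_n => /=; lia.
by case: (lt0 x y) lt_p => /= [->//|]; rewrite /ltw ltnNge leq_eqVlt negb_or => /andP[_ /negbTE->].
Qed.

Section LevelAverage.
Variables (F : realFieldType) (T : eqType) (inf : T) (s : seq T).
Hypotheses (Us : uniq s) (infs : inf \notin s) (s_gt1 : 1 < size s).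

Section PairFiber.
Variable w0 : seq T.
Hypothesis pw0 : perm_eq w0 s.

Let aa := winners w0 s.
Let fiber := filter (fun w => pairup (ltw w) s == pairup (ltw w0) s) (permutations s).
Let small sg := map (partner inf w0 s) sg ++ rest_of s.

Lemma fiberP w : w \in fiber ->
  [/\ perm_eq w s, winners w s = aa, main_chain w s = filter (mem aa) w &
      small_elts inf w s = small (filter (mem aa) w)].
Proof.
rewrite mem_filter mem_permutations => /andP[/eqP eqA pw]; split=> //.
- by rewrite /winners eqA.
- by rewrite /main_chain /winners eqA.
rewrite /small_elts /main_chain /winners eqA; congr (_ ++ _); apply: eq_map => x.
by rewrite /partner /losers /winners eqA.
Qed.

Section MainChainFiber.
Variable sg : seq T.
Hypothesis psg : perm_eq sg aa.

Lemma perm_small_level : perm_eq (sg ++ small sg) s.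
Proof.
apply: perm_trans (perm_level inf Us pw0); rewrite /small_elts /small.
have psg' : perm_eq sg (main_chain w0 s).
  by rewrite perm_sym (permPl (perm_main_chain Us pw0)) perm_sym.
by apply: perm_cat; rewrite // perm_cat2r perm_map.
Qed.

Lemma size_sg : size sg = (size s)./2.
Proof. by rewrite (perm_size psg) size_winners. Qed.

Lemma size_small : size (small sg) = uphalf (size s).
Proof. by rewrite size_cat size_map size_sg size_rest_of uphalf_half addnC. Qed.

Lemma uniq_small_level : uniq (sg ++ small sg).
Proof. by rewrite (perm_uniq perm_small_level). Qed.

Lemma inf_small_level : inf \notin sg ++ small sg.
Proof. by rewrite (perm_mem perm_small_level). Qed.

Lemma size_small_itv : size sg <= size (small sg) <= (size sg).+1.
Proof. by rewrite size_small size_sg uphalf_half; case: odd; rewrite /=; lia. Qed.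

(** For a word with main chain [sg], having the pairing of [w0] means that every loser lies below
    its winner, which is the constraint defining [omega]; the unpaired element is free. *)
Lemma mem_fiber_omega w :
  (w \in filter (fun w => filter (mem aa) w == sg) fiber) = (w \in omega inf sg (small sg)).
Proof.
rewrite mem_filter; apply/andP/idP => [[/eqP fw wf]|wO].
  have [pw eqw eqm eqs] := fiberP wf.
  rewrite fw in eqm eqs.
  rewrite mem_ext; last exact: omega_wf uniq_small_level inf_small_level.
  rewrite unzip1_all; apply/and3P; split.
  - by rewrite perm_sym perm_catC (permPl perm_small_level) perm_sym.
  - apply/eqP; rewrite -[RHS]fw; apply: eq_in_filter => x xw.
    rewrite /= -(perm_mem psg); move: uniq_small_level; rewrite cat_uniq.
    case/and3P=> _ /hasPn dis _; have : x \in sg ++ small sg.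
      by rewrite (perm_mem perm_small_level) -(perm_mem pw).
    rewrite mem_cat; case: (boolP (x \in sg)) => [xs _|_ /= ->] //.
    by apply: contraTN xs => /dis.
  apply/allP => _ /mapP[i + ->]; rewrite mem_iota => hi /=.
  have := @lt_small_elts _ inf w s Us infs pw i.-1.
  by rewrite eqm eqs; apply; lia.
have [pw fw lt_w] := omegaP uniq_small_level inf_small_level size_small_itv wO.
split; first by apply/eqP; rewrite -[RHS]fw; apply: eq_filter => x; rewrite /= (perm_mem psg).
rewrite mem_filter mem_permutations (permPl pw) perm_small_level andbT.
apply/eqP; apply: pairup_eq; rewrite (@pairupE _ inf w0 s Us) all_map.
apply/allP => x; rewrite -/aa -(perm_mem psg) => xs /=.
have lt_i : index x sg < size sg by rewrite index_mem.
have hi : 0 < (index x sg).+1 <= size (small sg).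
  by case/andP: size_small_itv => le_sz _; exact: leq_trans lt_i le_sz.
have := lt_w _ hi; rewrite /= nth_index // /small nth_cat size_map lt_i.
by rewrite (nth_map inf) // nth_index.
Qed.

Lemma perm_fiber_omega :
  perm_eq (filter (fun w => filter (mem aa) w == sg) fiber) (omega inf sg (small sg)).
Proof.
apply: uniq_perm; [|apply: omega_uniq|exact: mem_fiber_omega].
- by rewrite !filter_uniq // permutations_uniq.
- exact: uniq_small_level.
- exact: inf_small_level.
Qed.

End MainChainFiber.

Local Open Scope ring_scope.

(** The fibers over the main chains [sg] have equal size, so [c sg] is averaged over all orders of
    [aa]. The insertion term is bounded for each [sg] separately, and the recursive term averages by
    hypothesis. *)
Lemma pair_fiber_avg (B : F) :
    (mi_total (size s)./2)%:R <= ((size s)./2`!)%:R * B ->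
  \sum_(w <- fiber) (mi (size s) (ltw w) s).2%:R <=
    (size fiber)%:R * ((size s)./2%:R + B + level_bound F (uphalf (size s))).
Proof.
move=> leB; set h := (size s)./2 in leB *; set LB := level_bound F _.
pose c sg : F := h%:R + (mi h (ltw sg) aa).2%:R + LB.
have Uaa : uniq aa by apply: uniq_winners.
have sz_aa : size aa = h by apply: size_winners.
apply: (@sum_le_equal_fibers F _ _ (fun w => filter (mem aa) w) _ (permutations aa)
  (\prod_(i < uphalf (size s)) i.*2.+1) _ c).
- exact: permutations_uniq.
- move=> w /fiberP[pw eqw eqm _]; rewrite mem_permutations -eqm -eqw.
  exact: perm_main_chain.
- move=> sg; rewrite mem_permutations => psg.
  rewrite -size_filter (perm_size (perm_fiber_omega psg)).
  rewrite (size_omega (uniq_small_level psg) (inf_small_level psg) (size_small_itv psg)).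
  by rewrite size_small.
- move=> sg; rewrite mem_permutations => psg.
  rewrite -big_filter (perm_big _ (perm_fiber_omega psg)) /=.
  have avg := @insertion_avg F _ inf sg (small sg) (uniq_small_level psg)
    (inf_small_level psg) (size_small_itv psg).
  rewrite (eq_big_seq (fun w => h%:R + (mi h (ltw sg) aa).2%:R +
      (insertion_cost inf w sg (small sg))%:R)) => [|w wO]; last first.
    move: wO; rewrite -mem_fiber_omega // mem_filter => /andP[/eqP fw wf].
    have [pw eqw eqm eqs] := fiberP wf.
    by rewrite (mi_levelE Us infs pw s_gt1) eqm eqs eqw fw !natrD.
  rewrite big_split /= big_const_seq count_predT iter_addr_0 /c.
  have := size_omega (uniq_small_level psg) (inf_small_level psg) (size_small_itv psg).
  rewrite size_small // => <-; rewrite mulrDr -[X in X + _ <= _]mulr_natl lerD2l.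
  by rewrite /LB -(size_small psg).
rewrite size_permutations // sz_aa big_split big_split /= !big_const_seq !count_predT !iter_addr_0.
rewrite size_permutations // sz_aa -natr_sum.
have -> : (\sum_(w <- permutations aa) (mi h (ltw w) aa).2 = mi_total h)%N.
  by rewrite -[in LHS]sz_aa mi_total_words // sz_aa.
by rewrite !mulrDr -(mulr_natl (h%:R : F)) -(mulr_natl LB) lerD2r lerD2l.
Qed.

End PairFiber.

Local Open Scope ring_scope.

Lemma level_avg (B : F) :
    (mi_total (size s)./2)%:R <= ((size s)./2`!)%:R * B ->
  (mi_total (size s))%:R <=
    ((size s)`!)%:R * ((size s)./2%:R + B + level_bound F (uphalf (size s))).
Proof.
move=> leB; rewrite -(mi_total_words Us) natr_sum -(size_permutations Us).
apply: (@sum_le_fibers _ _ _ (fun w => pairup (ltw w) s)) => w0.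
rewrite mem_permutations => pw0.
by rewrite -big_filter -size_filter; apply: pair_fiber_avg.
Qed.

End LevelAverage.

(** * The recurrence over the levels *)

Lemma tJ_bracket n : 1 < n -> exists2 k, 1 < k <= n.+1 & tJ k.-1 < n <= tJ k.
Proof.
move=> n_gt1; have ex : exists k, n <= tJ k by exists n.+1; exact: leq_tJ.
case: (ex_minnP ex) => k le_nk k_min; exists k.
  apply/andP; split; last by apply: k_min; exact: leq_tJ.
  by case: k le_nk {k_min} => [|[|k]] //; rewrite leqNgt n_gt1.
rewrite le_nk andbT ltnNge; apply/negP => /k_min.
by case: k le_nk {k_min} => [|k _]; [rewrite leqNgt n_gt1|rewrite ltnn].
Qed.

Lemma leq_tJ_mono j k : j <= k -> tJ j <= tJ k.
Proof. by move=> le_jk; apply: (homo_leq leqnn leq_trans) le_jk => i; apply: leq_tJS. Qed.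

(** The induction step comes down to [t_{k+1} <= 2 t_k + 1]. At [k - 1] this yields the term
    [(k - 2) u] of [level_bound_le]. *)
Lemma sum_full_groups k : 0 < k ->
  \sum_(2 <= j < k.+1) (tJ j - tJ j.-1) * j + tJ k <= k * tJ k + k.
Proof.
elim: k => // -[|k] IH _; first by rewrite big_geq.
have {}IH := IH isT; rewrite big_nat_recr //=.
have := tJS_le k.+1; have := leq_tJS k.+1; move: (tJ k.+1) (tJ k.+2) IH => a b.
move: (\sum_(_ <= _ < _) _) => S; nia.
Qed.

Section Recurrence.
Local Open Scope ring_scope.
Variable F : realFieldType.

Lemma mi_total_le (B : nat -> F) :
    (forall n, (n <= 1)%N -> 0 <= B n) ->
    (forall n, (1 < n)%N -> n./2%:R + B n./2 + level_bound F (uphalf n) <= B n) ->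
  forall n, (mi_total n)%:R <= n`!%:R * B n.
Proof.
move=> B0 BS n; have [k] := ubnP n; elim: k n => // k IH n le_n.
have [n_le1|n_gt1] := leqP n 1.
  rewrite /mi_total big1 ?mulr_ge0 ?B0 ?ler0n // => w _.
  by case: n n_le1 {le_n} w => [|[|]] // _ w; rewrite /= size_enum_ord.
have infs : n \notin iota 0 n by rewrite mem_iota; lia.
have := @level_avg F _ n (iota 0 n) (iota_uniq 0 n) infs _ (B n./2).
rewrite size_iota => /(_ n_gt1) H; have := H (IH _ _) => {}H.
apply: le_trans (H _) _; first lia.
by rewrite ler_pM2l ?ltr0n ?fact_gt0 ?BS.
Qed.

Lemma level_bound1 : level_bound F 1 = 0.
Proof. by rewrite /level_bound big_seq1 big_nil. Qed.

(** With [u = t_{k-1} < n <= t_k], the complete groups cost at most [(k - 2) u + k]. In the last one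
    the error [(n - u) k / u] is at most [2 k], since [n <= 2 u + 1 <= 3 u]. *)
Lemma level_bound_le n : (1 < n)%N ->
  exists k u : nat,
  [/\ (1 < k)%N, (0 < u < n)%N, (u + n <= 2 ^ k)%N, (3 * u <= 2 ^ k + 1)%N
    & (2 ^ k <= 3 * u + 1)%N] /\
  level_bound F n <= (k%:R - 2) * u%:R +
    (n%:R - u%:R) * (k%:R + 1 - (2 ^ k)%:R / (u%:R + n%:R)) + 3 * k%:R.
Proof.
move=> n_gt1; have [k /andP[k_gt1 le_kn] /andP[lt_un le_nk]] := tJ_bracket n_gt1.
set u := tJ k.-1 in lt_un; exists k, u.
have u0 : (0 < u)%N by apply: tJ_gt0.
have kE : k = k.-1.+1 by lia.
have uk : (u + tJ k = 2 ^ k)%N by rewrite addnC [in tJ k]kE [in (2 ^ k)%N]kE tJS.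
split.
  split=> //; [by rewrite u0|by rewrite -uk leq_add2l| |].
    by have := tJ3 k.-1; rewrite -kE -/u; case: odd; lia.
  by have := tJ3 k.-1; rewrite -kE -/u; case: odd; lia.
have -> : level_bound F n =
    \sum_(2 <= j < k) ((tJ j - tJ j.-1) * j)%N%:R + (n - u)%:R * step_bound F k n.
  have lbE : level_bound F n =
      \sum_(2 <= j < n.+2) (minn (tJ j) n - tJ j.-1)%N%:R * step_bound F j n.
    rewrite /level_bound /index_iota subSS subSS subn0; apply: eq_bigr => j _.
    by rewrite big_const_seq count_predT iter_addr_0 size_rev size_iota mulr_natl.
  rewrite lbE (@big_cat_nat _ _ _ k.+1) //=; last by rewrite ltnW.
  rewrite big_nat_recr /=; last by [].
  rewrite [X in _ + X]big_nat_cond [X in _ + X]big1 => [|j /andP[/andP[lt_kj _] _]]; last first.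
    have le_uj : (n <= tJ j.-1)%N by apply: leq_trans le_nk (leq_tJ_mono _); lia.
    by rewrite (_ : (_ - _)%N = 0%N) ?mul0r //; lia.
  rewrite addr0 (minn_idPr le_nk); congr (_ + _); apply: eq_big_nat => j /andP[j2 lt_jk].
  have lt_jn : (tJ j < n)%N by apply: leq_ltn_trans lt_un; apply: leq_tJ_mono; lia.
  by rewrite (minn_idPl (ltnW lt_jn)) /step_bound lt_jn natrM.
rewrite -natr_sum /step_bound ltnNge le_nk /= /avg_depth -/u.
have W := @sum_full_groups k.-1; rewrite -kE -/u in W.
have {W} : (\sum_(2 <= j < k) (tJ j - tJ j.-1) * j + u <= k.-1 * u + k.-1)%N by apply: W; lia.
rewrite -(ler_nat F) !natrD natrM.
have -> : k.-1%:R = k%:R - 1 :> F by rewrite [in RHS]kE -natr1 addrK.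
have -> : (n - u)%:R = n%:R - u%:R :> F by rewrite natrB // ltnW.
have err : (n%:R - u%:R) * (k%:R / u%:R) <= 2 * k%:R :> F.
  have u0' : 0 < u%:R :> F by rewrite ltr0n.
  rewrite mulrA ler_pdivrMr // [leRHS]mulrAC ler_wpM2r //.
  have : (n <= 3 * u)%N by have := tJS_le k.-1; rewrite -kE -/u; lia.
  by rewrite -(ler_nat F) natrM; lra.
rewrite -natr1 mulrDr.
move: ((n%:R - u%:R) * (k%:R / u%:R)) err => e err.
move: ((n%:R - u%:R) * _) => G; move: (_%:R) => S.
by rewrite ?natrD; lra.
Qed.

End Recurrence.

Lemma avg_miE n : avg_mi n = ((mi_total n)%:R / n`!%:R)%R.
Proof.
rewrite /avg_mi mi_total_comparisons size_permutations ?iota_uniq // size_iota.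
by rewrite RdivE !INRE.
Qed.

Lemma INR_le m n : Rle (INR m) (INR n) <-> m <= n.
Proof. by rewrite !INRE; split => [/RleP|le_mn]; [rewrite ler_nat|apply/RleP; rewrite ler_nat]. Qed.

Delimit Scope R_scope with Re.

(** The recurrence restated in the operations of [Stdlib], so that the analytic estimates apply. [G]
    bounds the insertions of one level; [h] and [m] are the two halves of [n]. *)
Lemma avg_mi_le (B G : nat -> R) :
    (0 <= G 1%N)%Re ->
    (forall k u n : nat, 1 <= INR u -> INR u + 1 <= INR n -> INR u + INR n <= 2 ^ k ->
       3 * INR u <= 2 ^ k + 1 -> 2 ^ k <= 3 * INR u + 1 ->
       (INR k - 2) * INR u + (INR n - INR u) * (INR k + 1 - 2 ^ k / (INR u + INR n))
         + 3 * INR k <= G n)%Re ->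
    (0 <= B 0%N)%Re -> (0 <= B 1%N)%Re ->
    (forall h m : nat, 1 <= INR h -> INR h <= INR m -> INR m <= INR h + 1 ->
       INR h + B h + G m <= B (h + m)%N)%Re ->
  forall n, (avg_mi n <= B n)%Re.
Proof.
move=> G1 Glev B0 B1 BS n; rewrite avg_miE; apply/RleP.
rewrite ler_pdivrMr ?ltr0n ?fact_gt0 // mulrC; apply: mi_total_le => {n} [n|n n_gt1].
  by case: n => [|[|]] // _; apply/RleP.
have lbG : (level_bound R (uphalf n) <= G (uphalf n))%R.
  have [m1|m_gt1] := leqP (uphalf n) 1.
    have -> : uphalf n = 1 by rewrite uphalf_half in m1 *; lia.
    by rewrite level_bound1; apply/RleP.
  have [k [u [[k1 /andP[u0 lt_un] le_unk le_u le_k]]]] := level_bound_le R m_gt1.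
  move/le_trans; apply; apply/RleP.
  have P : pow (IZR 2) k = INR (2 ^ k) by rewrite RpowE INRE natrX.
  have e1 : IZR 1 = INR 1 by [].
  have e2 : IZR 2 = INR 2 := esym (INR_IZR_INZ 2).
  have e3 : IZR 3 = INR 3 := esym (INR_IZR_INZ 3).
  have := Glev k u (uphalf n); rewrite P e3 e2 e1 -!mult_INR -!plus_INR !INR_le.
  rewrite !plusE !multE [(u + 1)%N]addn1 => /(_ u0 lt_un le_unk le_u le_k).
  by rewrite !(RplusE, RminusE, RmultE, RdivE, INRE) !natrD addr0 (mulr_natl k%:R%R 3).
have nE : n./2 + uphalf n = n by rewrite uphalf_half; lia.
have h1 : INR 1 = IZR 1 := erefl.
have := BS n./2 (uphalf n); rewrite -h1 -plus_INR !INR_le plusE nE => /(_ _ _ _) H.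
have {}H : Rle (Rplus (Rplus (INR n./2) (B n./2)) (G (uphalf n))) (B n).
  by apply: H; rewrite ?uphalf_half; lia.
move/RleP: H; rewrite !RplusE INRE => H; apply: le_trans H.
by rewrite lerD2l.
Qed.

End Average.

(** * The explicit upper bound and the theorem *)

Definition mi_bound (n : nat) : R :=
  match n with
  | O => 0
  | _ => INR n * log2 (INR n) - 1.3999 * INR n + 1000010 * (log2 (INR n) + 1)
  end.

Lemma mi_boundE (n : nat) : 1 <= INR n -> mi_bound n =
  INR n * log2 (INR n) - 1.3999 * INR n + 1000010 * (log2 (INR n) + 1).
Proof. destruct n; simpl INR; [lra | reflexivity]. Qed.

Lemma log2_1 : log2 1 = 0.
Proof. unfold log2; rewrite ln_1; lra. Qed.

Lemma avg_mi_upper_bound (n : nat) : avg_mi n <= mi_bound n.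
Proof.
(* The constant in the second function covers the 1000000 of [log_error_absorbed]. With the 2 of
   [halving_convex] a level loses at most 1000005, and the last term of [mi_bound] gains at least
   1000010 from [h] to [h + m >= 2 h]. *)
apply (@Average.avg_mi_le
  mi_bound (fun m => INR m * (log2 (INR m) + 1 - 1.3999) + 1000003)).
- simpl INR; rewrite log2_1; lra.
- intros k u m u1 um umP uP Pu.
  pose proof (level_estimate k (INR u) (INR m) u1 um umP uP Pu).
  assert (H4 : 2 ^ k <= 4 * INR m) by lra.
  pose proof (log_error_absorbed k (INR m) H4); lra.
- simpl; lra.
- simpl; rewrite log2_1; lra.
- intros h m h1 hm mh.
  rewrite !mi_boundE by (rewrite ?plus_INR; lra); rewrite plus_INR.
  assert (h0 : 0 < INR h) by lra.
  pose proof (halving_convex (INR h) (INR m) h0 hm mh).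
  assert (log2 (2 * INR h) <= log2 (INR h + INR m)) by (apply log2_le; lra).
  rewrite log2_mult, log2_2 in * by lra.
  lra.
Qed.

Theorem theorem6 :
  exists c : nat -> R,
    (forall n : nat, 1.3999 <= c n) /\
    exists (C : R) (N : nat), forall n : nat, (N <= n)%nat ->
      Rabs (avg_mi n - (INR n * log2 (INR n) - c n * INR n))
        <= C * log2 (INR n).
Proof.
(* If the average is small, [c n] is the value that makes the difference 0. Otherwise
   [c n = 1.3999], the difference is nonnegative and the upper bound applies. *)
exists (fun n => Rmax 1.3999 (log2 (INR n) - avg_mi n / INR n)).
split; [intros n; apply Rmax_l |].
(* Twice 1000010, since [log2 n + 1 <= 2 log2 n] for [n >= 2]. *)
exists 2000020, 2%nat; intros n n2.
assert (N2 : 2 <= INR n) by (apply (le_INR 2), n2).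
assert (L1 : 1 <= log2 (INR n)) by (rewrite <- log2_2; apply log2_le; lra).
pose proof (avg_mi_upper_bound n) as H; rewrite mi_boundE in H by lra.
unfold Rmax; destruct (Rle_dec _ _) as [_ | gt_c].
- replace (avg_mi n - _) with 0 by (field; lra); rewrite Rabs_R0; lra.
- assert (lower : 0 <= avg_mi n - (INR n * log2 (INR n) - 1.3999 * INR n)).
  { apply Rnot_le_lt in gt_c; apply (Rmult_lt_compat_r (INR n)) in gt_c; [| lra].
    replace ((log2 (INR n) - avg_mi n / INR n) * INR n)
      with (INR n * log2 (INR n) - avg_mi n) in gt_c by (field; lra).
    lra. }
  rewrite Rabs_pos_eq by exact lower; lra.
Qed.
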